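(* Let $S$ be a countably infinite set with symmetric conductances $c_{x,y}=c_{y,x}\in[0,+\infty)$ satisfying Assumption SSEP. Given $f\in C(\{0,1\}^S)$ and $t\ge 0$, the map $S(t)f:\{0,1\}^S\to\mathbb R$ defined as $$\big(S(t)f\big)(\sigma):=\mathbb E\big[f(\eta^\sigma_t[\mathcal K])\big]=\int d\mathbb P^\sigma(\eta_\cdot)\,f(\eta_t)$$ belongs to $C(\{0,1\}^S)$. In particular, the symmetric simple exclusion process with conductances $c_{x,y}$ is a Feller process.
   Context: Setting. $S$ is a countably infinite set, $\mathcal E_S:=\{\{x,y\}: x\ne y,\ x,y\in S\}$. To each $\{x,y\}\in\mathcal E_S$ is associated a number $c_{x,y}=c_{y,x}\in[0,+\infty)$; $c_{x,x}:=0$. Assumption SSEP: (C1) $c_x:=\sum_{y\in S}c_{x,y}<+\infty$ for all $x\in S$; (C2) for each $x\in S$ the continuous-time random walk on $S$ starting at $x$ with jump rates $c_{y,z}$ (at $y$ it waits an exponential time of mean $1/c_y\in(0,+\infty]$, then jumps to $z$ with probability $c_{y,z}/c_y$) a.s. does not explode. Path spaces. For a metric space $W$, $D_W=D(\mathbb R_+,W)$ is the space of càdlàg paths $\mathbb R_+=[0,+\infty)\to W$ with the Skorohod topology and its Borel $\sigma$-algebra. $\mathbb N=\{0,1,\dots\}$ is discrete; $\{0,1\}^S$ has the product topology. $D_{\mathbb N}^{\mathcal E_S}$ has the product topology; its generic element is $\mathcal K=(\mathcal K_{x,y})_{\{x,y\}\in\mathcal E_S}$, with $\mathcal K_{x,y}=\mathcal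 K_{y,x}$. $\mathbb P$ (with expectation $\mathbb E$) is the law on $D_{\mathbb N}^{\mathcal E_S}$ of a family $(N_{x,y}(\cdot))_{\{x,y\}\in\mathcal E_S}$ of independent Poisson processes, $N_{x,y}$ having intensity $c_{x,y}$ and $N_{x,y}(0)=0$. Graphical construction. Let $\mathcal K_x(t):=\sum_{y\in S\setminus\{x\}}\mathcal K_{x,y}(t)$. $\Gamma$ is the set of $\mathcal K$ such that: (i) for all $x\in S$, $\mathcal K_x$ is finite-valued and càdlàg with jumps equal to $+1$; (ii) each $\mathcal K_{x,y}$ has only jumps equal to $+1$; (iii) for $\{x,y\}\neq\{x',y'\}$ the sets of jump times of $\mathcal K_{x,y}$ and $\mathcal K_{x',y'}$ are disjoint; (iv) $\mathcal K_{x,y}(0)=0$ for all $\{x,y\}$. For $\mathcal K\in\Gamma$, $t\ge0$, $x\in S$ define $X_t^x[\mathcal K]\in S\cup\{\partial\}$ ($\partial\notin S$ an abstract state): if $\mathcal K_x$ has no jump times in $[0,t]$, set $X^x_t[\mathcal K]:=x$; otherwise let $t_1$ be the largest jump time of $\mathcal K_x$ in $[0,t]$ and $x_1$ the unique site such that $t_1$ is a jump time of $\mathcal K_{x,x_1}$. Given $(t_k,x_k)$, $k\ge1$: if $\mathcal K_{x_k}$ has no jump times in $[0,t_k)$, set $X_t^x[\mathcal K]:=x_k$ and stop; otherwise let $t_{k+1}$ be the largest one and $x_{k+1}$ the unique site such that $t_{k+1}$ is a jump time of $\mathcal K_{x_k,x_{k+1}}$. If the algorithm never stops, $X_t^x[\mathcal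 K]:=\partial$. Let $\Gamma_*:=\{\mathcal K\in\Gamma: X_t^x[\mathcal K]\in S\ \forall x\in S,\ t\ge0\}$; it is Borel and $\mathbb P(\Gamma_* )=1$. For $\mathcal K\in\Gamma_*$ and $\sigma\in\{0,1\}^S$ set $\eta_t^\sigma[\mathcal K](x):=\sigma(X_t^x[\mathcal K])$; the path $\eta^\sigma_\cdot[\mathcal K]$ belongs to $D_{\{0,1\}^S}$ and is measurable in $\mathcal K$. $\mathbb P^\sigma(A):=\mathbb P(\mathcal K\in\Gamma_*:\eta^\sigma_\cdot[\mathcal K]\in A)$ for Borel $A\subset D_{\{0,1\}^S}$; the family $(\mathbb P^\sigma)_\sigma$ is a Markov process, called the symmetric simple exclusion process (SSEP) with conductances $c_{x,y}$. $C(\{0,1\}^S)$ is the space of real continuous functions on $\{0,1\}^S$ with the uniform norm. Feller means that $S(t)$ maps $C(\{0,1\}^S)$ into itself for all $t\geq 0$. *)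

(* Defs.v *)
From HB Require Import structures.
From mathcomp Require Import all_boot all_order all_algebra finmap.
From mathcomp Require Import all_classical all_reals all_analysis.
From mathcomp Require Import measurable_realfun.

Set Implicit Arguments.
Unset Strict Implicit.
Unset Printing Implicit Defensive.

Import Order.TTheory GRing.Theory Num.Theory.
Import numFieldNormedType.Exports.

Local Open Scope classical_set_scope.
Local Open Scope ring_scope.

Notation borel T := (g_sigma_algebraType (@open T)).

Section CadlagPaths.
Variable R : realType.

Definition is_cadlag (W : topologicalType) (w : R -> W) : Prop :=
  (forall t : R, 0 <= t -> w s @[s --> t^'+] --> w t) /\
  (forall t : R, 0 < t -> exists l : W, w s @[s --> t^'-] --> l).

(* D(R_+, W).  A path on R_+ is encoded by its extension to the whole line
   which is constant on the negative half-line, so that equality of paths is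
   equality of their restrictions to R_+. *)
Record cadlag (W : topologicalType) := Cadlag {
  path_of :> R -> W;
  path_of_cadlag : is_cadlag path_of;
  path_of_neg : forall t, t < 0 -> path_of t = path_of 0 }.

HB.instance Definition _ (W : topologicalType) := gen_eqMixin (cadlag W).
HB.instance Definition _ (W : topologicalType) := gen_choiceMixin (cadlag W).

Lemma cst_is_cadlag (W : topologicalType) (a : W) : is_cadlag (fun=> a).
Proof.
split=> t _; first exact: cvg_cst.
by exists a; exact: cvg_cst.
Qed.

HB.instance Definition _ (W : ptopologicalType) :=
  isPointed.Build (cadlag W)
    (@Cadlag W (fun=> point) (cst_is_cadlag point) (fun _ _ => erefl)).

Definition time_change (lam : R -> R) : Prop :=
  set_bij `[0, +oo[ `[0, +oo[ lam /\
  forall s t, 0 <= s -> s < t -> lam s < lam t.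

Section Skorohod.
Variable W : uniformType.

Definition skorohod_ball (x : cadlag W) (T eps : R) (E : set (W * W)) :
    set (cadlag W) :=
  [set y | exists2 lam, time_change lam &
    forall t, 0 <= t <= T -> `|lam t - t| < eps /\ E (y t, x (lam t))].

(* The Skorohod (J1) topology.  A sequence x_n converges to x in the usual
   Skorohod metric iff for every T there are time changes lam_n with
   sup_{t <= T} |lam_n t - t| -> 0 and
   sup_{t <= T} d (x_n t, x (lam_n t)) -> 0 (Ethier-Kurtz, Prop. 3.5.3), i.e.
   iff x_n is eventually in every [skorohod_ball x T eps E]; hence the sets
   below are exactly the open sets of that metric. *)
Definition skorohod_open (U : set (cadlag W)) : Prop :=
  forall x, U x -> exists T eps E,
    [/\ 0 < eps, entourage E & skorohod_ball x T eps E `<=` U].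

Lemma skorohod_openT : skorohod_open setT.
Proof. by move=> x _; exists 0, 1, setT; split=> //; exact: entourageT. Qed.

Lemma skorohod_openI : setI_closed skorohod_open.
Proof.
move=> U V oU oV x [/oU [T [e [E [e0 entE sU]]]] /oV [T' [e' [E' [e'0 entE' sV]]]]].
exists (Num.max T T'), (Num.min e e'), (E `&` E'); split.
- by rewrite lt_min e0.
- exact: filterI.
- move=> y [lam hlam hy]; split.
  + apply: sU; exists lam => // t /andP[t0 tT].
    have [|+ []//] := hy t; first by rewrite t0 le_max tT.
    by rewrite lt_min => /andP[].
  + apply: sV; exists lam => // t /andP[t0 tT].
    have [|+ []//] := hy t; first by rewrite t0 le_max tT orbT.
    by rewrite lt_min => /andP[].
Qed.

Lemma skorohod_open_bigU (I : Type) (f : I -> set (cadlag W)) :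
  (forall i, skorohod_open (f i)) -> skorohod_open (\bigcup_i f i).
Proof.
move=> oF x [i _ fix_]; have [T [e [E [e0 entE sF]]]] := oF i x fix_.
by exists T, e, E; split=> // y /sF; exists i.
Qed.

HB.instance Definition _ := isOpenTopological.Build (cadlag W)
  skorohod_openT skorohod_openI skorohod_open_bigU.

End Skorohod.
End CadlagPaths.

HB.instance Definition _ (I : Type) (T : I -> ptopologicalType) :=
  Pointed.copy (prod_topology T) (forall i, T i).

Section Conductances.
Variables (R : realType) (S : countType) (c : S -> S -> R).

Definition conductances : Prop :=
  [/\ forall x y, 0 <= c x y, forall x y, c x y = c y x
    & forall x, c x x = 0].

Definition locally_finite : Prop :=
  forall x, (\esum_(y in [set: S]) (c x y)%:E < +oo)%E.

Definition exit_rate (x : S) : R := fine (\esum_(y in [set: S]) (c x y)%:E).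

(* When the exit rate vanishes the waiting time is infinite and the value
   chosen here is immaterial. *)
Definition jump_prob (y z : S) : R :=
  if exit_rate y == 0 then (y == z)%:R else c y z / exit_rate y.

(* Y n is the n-th site visited by the walk started at x and T n the time spent
   there.  The joint law says that Y is the Markov chain with transition matrix
   [jump_prob] and that, given Y, the T n are independent, T n being
   exponential of parameter [exit_rate (Y n)] (T n = +oo if it is 0). *)
Definition random_walk (x : S) d (Omega : measurableType d)
    (Q : probability Omega R) (Y : nat -> Omega -> S)
    (T : nat -> Omega -> \bar R) : Prop :=
  [/\ forall n y, measurable (Y n @^-1` [set y]),
      forall n, measurable_fun setT (T n)
    & forall n (y : nat -> S) (u : nat -> R), (forall i, 0 <= u i) ->
      Q [set w | forall i, (i <= n)%N -> Y i w = y i /\ ((u i)%:E < T i w)%E] =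
      ((y 0%N == x)%:R * (\prod_(i < n) jump_prob (y i) (y i.+1)) *
       \prod_(i < n.+1) expR (- (exit_rate (y i) * u i)))%:E].

Definition non_explosive : Prop :=
  forall (x : S) d (Omega : measurableType d) (Q : probability Omega R)
    (Y : nat -> Omega -> S) (T : nat -> Omega -> \bar R),
  random_walk x Q Y T ->
  {ae Q, forall w, (\sum_(0 <= n <oo) T n w = +oo)%E}.

Definition assumption_SSEP : Prop := locally_finite /\ non_explosive.

End Conductances.

Definition edge (S : countType) : Type := {A : {fset S} | #|` A| == 2%N}.

Notation clocks R S := {ptws edge S -> cadlag R nat}.
Notation config S := {ptws S -> bool}.

Section PoissonFamily.
Variables (R : realType) (S : countType).

(* [poisson_prob r 0] is the Poisson law of parameter r, which is the Dirac mass
   at 0 when r = 0; its second argument is not used. *)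
Definition poisson_process d (Omega : measurableType d)
    (Q : probability Omega R) (r : R) (N : Omega -> cadlag R nat) : Prop :=
  Q [set w | N w 0 = 0%N] = 1%E /\
  forall n (t : nat -> R) (k : nat -> nat),
    0 <= t 0%N -> (forall i, t i <= t i.+1) ->
    Q [set w | forall i, (i < n)%N -> N w (t i.+1) = (N w (t i) + k i)%N] =
    (\prod_(i < n) poisson_prob (r * (t i.+1 - t i)) 0 [set k i])%E.

Definition poisson_clocks (c : S -> S -> R)
    (P : probability (borel (clocks R S)) R) : Prop :=
  (forall (e : edge S) (x y : S), val e = [fset x; y]%fset ->
     poisson_process P (c x y) (fun K => K e)) /\
  (forall (s : {fset edge S}) (A : edge S -> set (borel (cadlag R nat))),
     (forall e, measurable (A e)) ->
     P [set K | forall e, e \in s -> A e (K e)] =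
     (\prod_(e <- s) P [set K | A e (K e)])%E).

End PoissonFamily.

Section GraphicalConstruction.
Variables (R : realType) (S : countType).
Implicit Types (K : clocks R S) (e : edge S) (x y : S) (t : R).

(* For cadlag g, being discontinuous at t means g (t-) <> g t. *)
Definition jump_time (g : R -> R) t : Prop :=
  0 < t /\ ~ (g s @[s --> t^'-] --> g t).

Definition unit_jumps (g : R -> R) : Prop :=
  forall t, jump_time g t -> g s @[s --> t^'-] --> g t - 1.

Definition clock K e : R -> R := fun t => (K e t)%:R.

(* K_x is the sum of the K_{x,y} over y <> x, i.e. over the edges containing x. *)
Definition site_count K x t : \bar R :=
  (\esum_(e in [set e : edge S | x \in val e]) (clock K e t)%:E)%E.

Definition site_clock K x : R -> R := fun t => fine (site_count K x t).

Definition Gamma : set (clocks R S) :=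
  [set K |
    [/\ forall x, [/\ forall t, 0 <= t -> site_count K x t \is a fin_num,
                      is_cadlag (site_clock K x) & unit_jumps (site_clock K x)],
        forall e, unit_jumps (clock K e),
        forall e e', e != e' ->
          forall t, ~ (jump_time (clock K e) t /\ jump_time (clock K e') t)
      & forall e, K e 0 = 0%N]].

Definition last_jump (g : R -> R) (I : set R) (t : R) : Prop :=
  [/\ I t, jump_time g t & forall s, I s -> jump_time g s -> s <= t].

(* [backtrack K I x y]: the backward algorithm, started at x and looking for jump
   times in I, stops after finitely many steps at y. *)
Inductive backtrack K : set R -> S -> S -> Prop :=
| backtrack_stop I x :
    (forall s, I s -> ~ jump_time (site_clock K x) s) -> backtrack K I x x
| backtrack_jump I x s e x1 y :
    last_jump (site_clock K x) I s ->
    val e = [fset x; x1]%fset -> jump_time (clock K e) s ->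
    backtrack K `[0, s[ x1 y -> backtrack K I x y.

(* X_t^x, the state \partial being None. *)
Definition backward_site K t x : option S :=
  xget None [set Some y | y in backtrack K `[0, t] x].

Definition Gamma_star : set (clocks R S) :=
  Gamma `&` [set K | forall x t, 0 <= t -> backward_site K t x != None].

(* The default value false is never used when K is in Gamma_star and 0 <= t. *)
Definition eta K (sigma : config S) t : config S :=
  fun x => if backward_site K t x is Some y then sigma y else false.

Variable P : probability (borel (clocks R S)) R.

Definition SSEP_semigroup t (f : config S -> R) (sigma : config S) : R :=
  \int[P]_(K in Gamma_star) f (eta K sigma t).

Definition SSEP_law (sigma : config S) (A : set (borel (cadlag R (config S)))) :
    \bar R :=
  P [set K | Gamma_star K /\
      exists2 w : cadlag R (config S), A w &
        forall t, 0 <= t -> w t = eta K sigma t].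

End GraphicalConstruction.

(* The library integral makes sense for a bare set function, so that the laws need
   not be packaged as measures; for SSEP_law the set function is a measure on
   the Borel sets because eta depends measurably on the clocks. *)
Definition law_semigroup (R : realType) (S : countType)
    (law : config S -> set (borel (cadlag R (config S))) -> \bar R)
    (t : R) (f : config S -> R) (sigma : config S) : R :=
  fine (\int[law sigma]_w (f ((w : cadlag R (config S)) t))%:E)%E.

Definition feller (R : realType) (S : countType)
    (law : config S -> set (borel (cadlag R (config S))) -> \bar R) : Prop :=
  forall (t : R) (f : config S -> R),
    0 <= t -> continuous f -> continuous (law_semigroup law t f).

(* Main.v *)
Require Import Defs.
From mathcomp Require Import all_boot all_order all_algebra finmap.
From mathcomp Require Import all_classical all_reals all_analysis.
From mathcomp Require Import measurable_realfun.
From mathcomp Require Import ring lra.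

Set Implicit Arguments.
Unset Strict Implicit.
Unset Printing Implicit Defensive.

Import Order.TTheory GRing.Theory Num.Theory.
Import numFieldNormedType.Exports.

Local Open Scope classical_set_scope.
Local Open Scope ring_scope.

(** For fixed clocks K in Gamma_star, the configuration at time t is sigma read
    at the sites X_t^x.  Each of these is a single site, so that the
    configuration at time t depends continuously on sigma; a continuous f being
    bounded on the compact space of configurations, dominated convergence gives
    the continuity of S(t)f ([continuous_semigroup]).

    What has to be built is measurability.  The second expression of S(t)f is an
    integral over the Skorohod space of configuration-valued paths, against the
    image of P by the map K |-> eta[K].  It agrees with the first one
    ([law_semigroupE]) once this map is Borel, for all Skorohod-open sets
    ([measurable_exclusion_path]), and evaluation at a fixed time is Borel
    ([measurable_evaluation]).

    Evaluation is a countable intersection of open conditions, because a cadlag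
    path visits an open set at times in ]t, t + h[ stably under small
    perturbations.

    The map K |-> eta[K] is not continuous: a small perturbation of K in the
    product topology may let arbitrarily distant clocks ring early.  It does
    become continuous under the constraint that, around a finite set A of sites
    and up to time n, no clock outside a finite set B rings.  These constraints
    are closed, countable in number, and every K in Gamma satisfies many of them; a
    condition on K which holds near every point relative to one of them is
    therefore Borel ([measurable_quietly_near]).

    The relative continuity is [backward_site_stable].  On a bounded time
    interval the backward algorithm started in a finite set F visits a finite
    set A of sites ([backtrack_in_uniform]), and finitely many clocks ring
    around A.  If K' is close to K and subject to the constraint, each of the
    latter clocks is moved by a small time change of its own.  As the jump times
    of K are distinct, hence well separated, their order is preserved, and a
    single piecewise linear time change lam matches them with those of K'
    ([common_time_change]).  The algorithms for (K', t) and (K, lam t) then make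
    the same choices.  This also shows that Gamma_star is Borel.  As for Gamma, it
    amounts to countably many closed or G_delta conditions ([GammaE],
    [measurable_Gamma]). *)

(** * Time changes *)

Section TimeChanges.
Variable R : realType.
Implicit Types (lam mu : R -> R) (s t : R).

Lemma time_change_ge0 lam t : time_change lam -> 0 <= t -> 0 <= lam t.
Proof.
move=> [[fl _ _] _] t0; have := fl t.
by rewrite /= !in_itv /= !andbT; apply.
Qed.

Lemma time_change_surj lam t : time_change lam -> 0 <= t ->
  exists2 s, 0 <= s & lam s = t.
Proof.
move=> [[_ _ sl] _] t0; have [|s] := sl t; first by rewrite /= in_itv /= t0.
by rewrite /= in_itv /= andbT => s0 <-; exists s.
Qed.

Lemma time_change_lt lam s t : time_change lam -> 0 <= s -> 0 <= t ->
  (lam s < lam t) = (s < t).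
Proof.
move=> [_ il] s0 t0; have [st|ts|->] := ltgtP s t; last by rewrite ltxx.
- exact: il.
- by apply: le_gtF; apply/ltW/il.
Qed.

Lemma time_change_le lam s t : time_change lam -> 0 <= s -> 0 <= t ->
  (lam s <= lam t) = (s <= t).
Proof. by move=> hl s0 t0; rewrite !leNgt time_change_lt. Qed.

Lemma time_change_inj lam s t : time_change lam -> 0 <= s -> 0 <= t ->
  lam s = lam t -> s = t.
Proof.
move=> hl s0 t0 e; apply/eqP; rewrite eq_le -(time_change_le hl s0 t0).
by rewrite -(time_change_le hl t0 s0) e lexx.
Qed.

Lemma time_change0 lam : time_change lam -> lam 0 = 0.
Proof.
move=> hl; have [s s0 ls] := time_change_surj hl (lexx 0).
by apply/eqP; rewrite eq_le (time_change_ge0 hl)// andbT -[leRHS]ls time_change_le.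
Qed.

Lemma time_change_gt0 lam t : time_change lam -> 0 < t -> 0 < lam t.
Proof.
by move=> hl t0; rewrite -(time_change0 hl) time_change_lt// ltW.
Qed.

Lemma time_change_can lam mu :
  (forall t, 0 <= t -> 0 <= lam t) -> (forall t, 0 <= t -> 0 <= mu t) ->
  (forall t, 0 <= t -> lam (mu t) = t) ->
  (forall s t, 0 <= s -> s < t -> lam s < lam t) -> time_change lam.
Proof.
move=> l0 m0 lm il; split=> //; split.
- by move=> t; rewrite /= !in_itv /= !andbT; exact: l0.
- move=> s t; rewrite !inE /= !in_itv /= !andbT => s0 t0 e.
  by have [/(il _ _ s0)|/(il _ _ t0)|//] := ltgtP s t; rewrite e ltxx.
- move=> t; rewrite /= !in_itv /= !andbT => t0.
  by exists (mu t); [rewrite /= in_itv /= m0|exact: lm].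
Qed.

Lemma time_change_id : time_change (@id R).
Proof. exact: (@time_change_can id id). Qed.

Lemma time_change_comp lam mu :
  time_change lam -> time_change mu -> time_change (lam \o mu).
Proof.
move=> hl hm; split; first exact: set_bij_comp hm.1 hl.1.
move=> s t s0 st /=; have t0 : 0 <= t by rewrite (le_trans s0)// ltW.
by rewrite (time_change_lt hl) ?(time_change_lt hm) ?(time_change_ge0 hm).
Qed.

(** Closeness to the identity is only known up to time T, so that preimages are
    controlled up to time T - eps. *)
Lemma time_change_preimage lam (T eps u : R) : time_change lam -> 0 < eps ->
  (forall t, 0 <= t <= T -> `|lam t - t| < eps) -> 0 <= u -> u + eps <= T ->
  exists s, [/\ 0 <= s, s <= T, lam s = u & `|s - u| < eps].
Proof.
move=> hl e0 cl u0 uT; have [s s0 ls] := time_change_surj hl u0.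
have T0 : 0 <= T by lra.
have sT : s <= T.
  rewrite -(time_change_le hl)// ls.
  by have := cl T; rewrite T0 lexx /= => /(_ isT); rewrite ltr_norml => /andP[? ?]; lra.
exists s; split=> //; rewrite distrC -ls; apply: cl; by rewrite s0.
Qed.

(** The maps of parameters p, c, d and p, d, c are inverse to each other. *)
Definition kink (p c d t : R) : R :=
  if t <= p then t else if t <= c then p + (t - p) * ((d - p) / (c - p))
  else t + (d - c).

Lemma kinkK p c d t : p < c -> p < d -> kink p c d (kink p d c t) = t.
Proof.
move=> pc pd; rewrite /kink; have [tp|pt] := leP t p; first by rewrite tp.
have q0 : 0 < (c - p) / (d - p) by rewrite divr_gt0// subr_gt0.
have cp : c - p != 0 by rewrite subr_eq0 gt_eqF.
have dp : d - p != 0 by rewrite subr_eq0 gt_eqF.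
have [td|dt] := leP t d.
- have tp : 0 < (t - p) * ((c - p) / (d - p)) by apply: mulr_gt0 q0; rewrite subr_gt0.
  rewrite leNgt ltrDl tp /=.
  have -> : p + (t - p) * ((c - p) / (d - p)) <= c.
    rewrite addrC -lerBrDr mulrCA ler_piMr ?subr_ge0 ?(ltW pc)//.
    by rewrite ler_pdivrMr ?subr_gt0// mul1r lerB.
  by field; rewrite cp dp.
- rewrite leNgt (_ : p < t + (c - d)); last by lra.
  by rewrite /= leNgt (_ : c < t + (c - d)) /=; lra.
Qed.

Lemma kink_lt p c d s t : p < c -> p < d -> s < t -> kink p c d s < kink p c d t.
Proof.
move=> pc pd st; rewrite /kink.
have q0 : 0 < (d - p) / (c - p) by rewrite divr_gt0// subr_gt0.
have cp : c - p != 0 by rewrite subr_eq0 gt_eqF.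
have qc : (c - p) * ((d - p) / (c - p)) = d - p by field.
have mono x y : x < y -> x * ((d - p) / (c - p)) < y * ((d - p) / (c - p)).
  by move=> xy; rewrite ltr_pM2r.
have monoW x y : x <= y -> x * ((d - p) / (c - p)) <= y * ((d - p) / (c - p)).
  by move=> xy; rewrite ler_pM2r.
have [sp|ps] := leP s p; have [tp|pt] := leP t p => //; try lra.
- have [tc|ct] := leP t c; last by lra.
  by have := mono 0 (t - p); rewrite mul0r => ?; lra.
- have [sc|cs] := leP s c; have [tc|ct] := leP t c; try lra.
  + by have := mono (s - p) (t - p) => ?; lra.
  + by have := monoW (s - p) (c - p); rewrite qc => ?; lra.
Qed.

Lemma time_change_kink p c d : 0 <= p -> p < c -> p < d -> time_change (kink p c d).
Proof.
move=> p0 pc pd; have k0 a b t : p < a -> p < b -> 0 <= t -> 0 <= kink p a b t.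
  move=> pa pb t0; have kp : kink p a b p = p by rewrite /kink lexx.
  have [tp|pt] := leP t p; first by rewrite /kink tp.
  by rewrite (le_trans p0)// -{1}kp ltW// kink_lt.
apply: (@time_change_can _ (kink p d c)).
- by move=> t; exact: k0.
- by move=> t; exact: k0.
- by move=> t _; exact: kinkK.
- by move=> s t _; exact: kink_lt.
Qed.

End TimeChanges.

Section Interpolation.
Variable R : realType.

Lemma path_le_last (x y : R) (s : seq R) :
  path <%R x s -> y \in x :: s -> y <= last x s.
Proof.
elim/last_ind: s => [|s z IH]; first by rewrite inE => _ /eqP ->.
rewrite rcons_path last_rcons -rcons_cons mem_rcons in_cons => /andP[ps sz].
by case/predU1P => [->//|/(IH ps) /le_trans]; apply; exact: ltW.
Qed.

(** Piecewise linear interpolation.  Each step composes the time change built so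
    far, which is a translation beyond the last interpolated point, with a kink
    located there; closeness to the identity between two points follows by
    convexity. *)
Lemma time_change_path (l : seq R) (g : R -> R) (eps : R) : 0 < eps ->
  path <%R 0 l -> path <%R 0 (map g l) ->
  (forall s, s \in l -> `|g s - s| < eps) ->
  exists lam, [/\ time_change lam, forall s, s \in l -> lam (g s) = s,
    forall t, 0 <= t -> `|lam t - t| < eps
    & forall t, last 0 (map g l) <= t ->
        lam t = t + (last 0 l - last 0 (map g l))].
Proof.
move=> e0; elim/last_ind: l => [_ _ _|l b' IH].
  exists id; split=> //; first exact: time_change_id.
  - by move=> t _; rewrite subrr normr0.
  - by move=> t _; rewrite /= subrr addr0.
rewrite map_rcons !rcons_path => /andP[pl bb'] /andP[pgl aa'] cl.
have [|lam [tl il cll sl]] := IH pl pgl.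
  by move=> s sl; apply: cl; rewrite mem_rcons in_cons sl orbT.
have : `|g b' - b'| < eps by apply: cl; rewrite mem_rcons mem_head.
rewrite !last_rcons; move: aa' bb' sl.
have a0 : 0 <= last 0 (map g l) by apply: path_le_last; rewrite ?mem_head.
have b0 : 0 <= last 0 l by apply: path_le_last; rewrite ?mem_head.
have := path_le_last (y := g _) pgl.
move: a0 b0; set a := last 0 (map g l); set b := last 0 l; set a' := g b'.
move=> a0 b0 ga aa' bb' sl cb'.
have la : lam a = b by rewrite sl//; lra.
have lab t : 0 <= t -> t <= a -> lam t <= b.
  by move=> t0 ta; rewrite -la (time_change_le tl).
exists (kink b (a' + (b - a)) b' \o lam).
have c0 : b < a' + (b - a) by lra.
have kb t : 0 <= t -> t <= a -> kink b (a' + (b - a)) b' (lam t) = lam t.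
  by move=> t0 ta; rewrite /kink lab.
split.
- by apply: time_change_comp tl; exact: time_change_kink.
- move=> s; rewrite mem_rcons in_cons => /predU1P[->|sl'] /=.
    rewrite -/a' sl ?(ltW aa')// /kink leNgt c0 /= lexx addrC.
    by field; rewrite lt0r_neq0//; lra.
  have gsl : g s \in map g l by apply/mapP; exists s.
  rewrite kb ?il//.
    by have := order_path_min lt_trans pgl => /allP /(_ _ gsl) /ltW.
  by apply: ga; rewrite in_cons gsl orbT.
- move=> t t0 /=; have [ta|ta] := leP t a; first by rewrite kb// cll.
  rewrite sl ?(ltW ta)// /kink leNgt (_ : b < t + (b - a)) /=; last by lra.
  have [ta'|ta'] := leP (t + (b - a)) (a' + (b - a)); last first.
    by rewrite (_ : _ - t = - (a' - b')) ?normrN//; lra.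
  have := cll a a0; rewrite la => cba.
  pose th := (t - a) / (a' - a).
  have aa0 : 0 < a' - a by lra.
  have th0 : 0 <= th by apply: divr_ge0; lra.
  have th1 : th <= 1 by rewrite ler_pdivrMr// mul1r; lra.
  have -> : b + (t + (b - a) - b) * ((b' - b) / (a' + (b - a) - b)) - t =
      (1 - th) * (b - a) + th * (b' - a').
    by rewrite /th; field; rewrite lt0r_neq0//=; lra.
  have bba : `|b' - a'| < eps by rewrite distrC.
  clearbody th; rewrite (le_lt_trans (ler_normD _ _))// !normrM (ger0_norm th0).
  rewrite (ger0_norm (_ : 0 <= 1 - th)) ?subr_ge0//.
  have [m1 m2] : (1 - th) * `|b - a| <= (1 - th) * Num.max `|b - a| `|b' - a'| /\
      th * `|b' - a'| <= th * Num.max `|b - a| `|b' - a'|.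
    by split; apply: ler_wpM2l; rewrite ?subr_ge0// le_max lexx ?orbT.
  rewrite (le_lt_trans (lerD m1 m2))// -mulrDl subrK mul1r gt_max cba.
  by rewrite bba.
- move=> t ta' /=; have ta : a < t by exact: lt_le_trans ta'.
  rewrite sl ?(ltW ta)// /kink leNgt (_ : b < t + (b - a)) /=; last by lra.
  have [ta''|ta''] := leP (t + (b - a)) (a' + (b - a)); last by lra.
  have -> : t = a' by apply/eqP; rewrite eq_le ta' andbT; lra.
  by field; rewrite lt0r_neq0//; lra.
Qed.

Lemma time_change_interpolation (D : set R) (g : R -> R) (eps : R) : 0 < eps ->
  finite_set D -> (forall s, D s -> 0 < s) -> (forall s, D s -> 0 < g s) ->
  (forall s t, D s -> D t -> s < t -> g s < g t) ->
  (forall s, D s -> `|g s - s| < eps) ->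
  exists lam, [/\ time_change lam, forall s, D s -> lam (g s) = s &
    forall t, 0 <= t -> `|lam t - t| < eps].
Proof.
move=> e0 /finite_seqP[s0 ->] D0 g0 gi ge.
pose l := sort <=%R (undup s0).
have memE s : (s \in l) = (s \in s0) by rewrite mem_sort mem_undup.
have sl : sorted <%R l.
  by rewrite sort_lt_sorted undup_uniq.
have pl : path <%R 0 l.
  by rewrite path_min_sorted//; apply/allP => s; rewrite memE => /D0.
have pgl : path <%R 0 (map g l).
  rewrite path_min_sorted; last first.
    by apply/allP => _ /mapP[s + ->]; rewrite memE => /g0.
  apply: (homo_sorted_in (P := [in s0])) sl; last by apply/allP => s; rewrite memE.
  by move=> s t ? ?; exact: gi.
have [|lam [tl il cl _]] := time_change_path e0 pl pgl.
  by move=> s; rewrite memE => /ge.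
by exists lam; split=> // s Ds; apply: il; rewrite memE.
Qed.

End Interpolation.

(** * Integer-valued paths *)

Section OneSided.
Variable R : realType.

Lemma near_at_rightP (t : R) (P : R -> Prop) :
  (\forall s \near t^'+, P s) <->
  exists2 d, 0 < d & forall s, t < s -> s < t + d -> P s.
Proof.
split.
- move=> /nbhs_ballP[d /= d0 dP]; exists d => // s ts std; apply: dP => //.
  by rewrite /ball /= distrC gtr0_norm ?subr_gt0//; lra.
- move=> [d d0 dP]; apply/nbhs_ballP; exists d => //= s.
  by rewrite /ball /= ltr_norml => /andP[? ?] ts; apply: dP => //; lra.
Qed.

Lemma near_at_leftP (t : R) (P : R -> Prop) :
  (\forall s \near t^'-, P s) <->
  exists2 d, 0 < d & forall s, t - d < s -> s < t -> P s.
Proof.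
split.
- move=> /nbhs_ballP[d /= d0 dP]; exists d => // s ts std; apply: dP => //.
  by rewrite /ball /= gtr0_norm ?subr_gt0//; lra.
- move=> [d d0 dP]; apply/nbhs_ballP; exists d => //= s.
  by rewrite /ball /= ltr_norml => /andP[? ?] ts; apply: dP => //; lra.
Qed.

(** Induction along a real interval: the supremum of the points up to which P
    holds is reached, and cannot lie strictly inside. *)
Lemma real_induction (a b : R) (P : R -> Prop) :
  (forall u, a <= u -> u <= b -> (forall v, a <= v -> v < u -> P v) -> P u) ->
  (forall u, a <= u -> u < b -> P u ->
    exists2 d, 0 < d & forall v, u < v -> v < u + d -> P v) ->
  a <= b -> P b.
Proof.
move=> lim step ab.
pose E : set R := [set u | a <= u <= b /\ forall v, a <= v <= u -> P v].
have Ea : E a.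
  split; first by rewrite lexx.
  by move=> v; rewrite -eq_le => /eqP <-; apply: lim => // v'; lra.
have ubE : ubound E b by move=> u [/andP[]].
have hsE : has_sup E by split; [exists a | exists b].
have sa : a <= sup E by apply: ub_le_sup => //; case: hsE.
have sb : sup E <= b by apply: ge_sup => //; exists a.
have lts v : a <= v -> v < sup E -> P v.
  move=> av vs; have e0 : 0 < sup E - v by rewrite subr_gt0.
  by have [u [_ Eu] vu] := sup_adherent e0 hsE; apply: Eu; rewrite av /=; lra.
have Ps : P (sup E) by apply: lim => // v; exact: lts.
have [sb'|bs] := ltP (sup E) b; last first.
  by have -> : b = sup E by apply/eqP; rewrite eq_le bs.
have [d d0 dP] := step _ sa sb' Ps.
pose u := Num.min b (sup E + d / 2).
have Eu : E u.
  split; first by rewrite /u le_min ge_min lexx ab /=; lra.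
  move=> v /andP[av]; rewrite /u le_min => /andP[vb vs].
  have [vs'|sv|->//] := ltgtP v (sup E); first exact: lts.
  by apply: dP => //; lra.
have : u <= sup E by apply: ub_le_sup => //; case: hsE.
by rewrite /u ge_min => /orP[]; lra.
Qed.

Lemma finite_separated (D : set R) : finite_set D ->
  exists2 d, 0 < d & forall s t, D s -> D t -> s < t -> s + d <= t.
Proof.
move=> /finite_seqP[l ->] /=.
pose gaps := [seq t - s | s <- l, t <- [seq t <- l | s < t]].
have gap0 x : x \in gaps -> 0 < x.
  move=> /allpairsPdep[s [t [_ + ->]]].
  by rewrite mem_filter subr_gt0 => /andP[].
have [d d0 dP] : exists2 d, 0 < d & forall x, x \in gaps -> d <= x.
  elim: gaps gap0 => [_|x g IH g0]; first by exists 1.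
  have [|d d0 dP] := IH; first by move=> y yg; apply: g0; rewrite in_cons yg orbT.
  exists (Num.min x d); first by rewrite lt_min d0 g0 ?mem_head.
  move=> y; rewrite in_cons => /predU1P[->|/dP dy]; rewrite ge_min ?lexx//.
  by rewrite dy orbT.
exists d => // s t sl tl st; rewrite addrC -lerBrDr; apply: dP.
by apply/allpairsPdep; exists s, t; split=> //; rewrite mem_filter st.
Qed.

End OneSided.

Section StepPaths.
Variable R : realType.
Implicit Types (w : cadlag R nat) (t : R) (l : nat).

Definition is_left_value w t l : Prop :=
  exists2 d : R, 0 < d & forall s : R, t - d < s -> s < t -> w s = l.

Definition left_value w t : nat := xget 0%N (is_left_value w t).

Lemma cadlag_right w t : 0 <= t ->
  exists2 d : R, 0 < d & forall s : R, t < s -> s < t + d -> w s = w t.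
Proof.
move=> t0; have [+ _] := path_of_cadlag w; move=> /(_ t t0) wt.
by apply/near_at_rightP; apply: (wt [set x | x = w t]).
Qed.

Lemma is_left_value_inj w t l l' :
  is_left_value w t l -> is_left_value w t l' -> l = l'.
Proof.
move=> [d d0 dl] [d' d0' dl'].
have m0 : 0 < Num.min d d' by rewrite lt_min d0.
have [m1 m2] : Num.min d d' <= d /\ Num.min d d' <= d'.
  by rewrite !ge_min !lexx orbT.
pose m := t - Num.min d d' / 2.
have <- : w m = l by apply: dl; rewrite /m; lra.
by apply: dl'; rewrite /m; lra.
Qed.

Lemma left_valueP w t : 0 < t -> is_left_value w t (left_value w t).
Proof.
move=> t0; rewrite /left_value; case: xgetP => [//|nl].
have [_ +] := path_of_cadlag w; move=> /(_ t t0) [l wl].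
by case: (nl l); apply/near_at_leftP; apply: (wl [set x | x = l]).
Qed.

Lemma left_value_eq w t l : 0 < t -> is_left_value w t l -> left_value w t = l.
Proof. by move=> t0; apply/is_left_value_inj/left_valueP. Qed.

Definition jumps w t : Prop := 0 < t /\ w t <> left_value w t.

Lemma cvg_left_value w t : 0 < t ->
  (w s)%:R @[s --> t^'-] --> ((left_value w t)%:R : R).
Proof.
move=> t0; have [d d0 dl] := left_valueP w t0; apply: cvg_near_cst.
by apply/near_at_leftP; exists d => // s ? ?; rewrite dl.
Qed.

Lemma cvg_natr_left w t (x : R) : 0 < t ->
  (w s)%:R @[s --> t^'-] --> x -> x = (left_value w t)%:R.
Proof. move=> t0 wx; exact: (norm_cvg_unique wx (cvg_left_value t0)).
Qed.

Lemma jump_timeE w t : jump_time (fun s => (w s)%:R) t <-> jumps w t.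
Proof.
split=> -[t0 wt]; split=> //.
- by move=> e; apply: wt; rewrite e; exact: cvg_left_value.
- by move=> /(cvg_natr_left t0)/eqP; rewrite eqr_nat => /eqP.
Qed.

Lemma unit_jumpsE w : unit_jumps (fun s => (w s)%:R) <->
  forall t, jumps w t -> w t = (left_value w t).+1.
Proof.
split=> H t.
- move=> jt; have [t0 _] := jt; have /jump_timeE/H/(cvg_natr_left t0)/eqP := jt.
  by rewrite subr_eq natr1 eqr_nat => /eqP.
- move=> /jump_timeE jt; have [t0 _] := jt.
  by rewrite (H _ jt) -natr1 addrK; exact: cvg_left_value.
Qed.

(** Neither passing to the right of a time nor reaching it from the left can
    make the path decrease. *)
Lemma unit_jumps_homo w s t : unit_jumps (fun s => (w s)%:R) ->
  0 <= s -> s <= t -> (w s <= w t)%N.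
Proof.
move=> /unit_jumpsE uw s0 st.
apply: (@real_induction _ s t (fun u => w s <= w u)%N) => //.
- move=> u su ut IH; have [us|us] := leP u s.
    by have -> : u = s by apply/eqP; rewrite eq_le us.
  have u0 : 0 < u by exact: le_lt_trans us.
  have [d d0 dl] := left_valueP w u0.
  have lw : (w s <= left_value w u)%N.
    have m : Num.max s (u - d / 2) < u by rewrite gt_max us /=; lra.
    rewrite -(dl (Num.max s (u - d / 2)))//; last first.
      by rewrite lt_max; apply/orP; right; lra.
    by apply: IH => //; rewrite le_max lexx.
  have [->//|/eqP wu] := eqVneq (w u) (left_value w u).
  by rewrite (uw u)// leqW.
- move=> u su ut wu; have [|d d0 dr] := @cadlag_right w u; first exact: le_trans su.
  by exists d => // v uv vd; rewrite (dr v).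
Qed.

(** Jump times cannot accumulate, since the path is constant on both sides of
    a small punctured neighbourhood of every time. *)
Lemma finite_jumps w T : finite_set [set t | jumps w t /\ t <= T].
Proof.
apply: contrapT => infJ.
have [|l] := infinite_bounded_limit_point_nonempty infJ.
  exists T; split; first exact: num_real.
  move=> M TM t [[t0 _] tT] /=; rewrite gtr0_norm//; lra.
have iso (x : R) : exists2 d, 0 < d & forall t, `|x - t| < d -> jumps w t -> t = x.
  have [x0|x0] := ltP x 0.
    exists (- x); first by lra.
    by move=> t; rewrite ltr_norml => /andP[? ?] [t0 _]; lra.
  have [d d0 dr] := cadlag_right w x0.
  have [d' d0' dl] : exists2 d', 0 < d' &
      forall s, x - d' < s -> s < x -> ~ jumps w s.
    have [xp|xn] := ltP 0 x; last by exists 1 => // s _ sx [s0 _]; lra.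
    have [d' d0' dl] := left_valueP w xp; exists d' => // s sd sx [s0].
    apply; apply/esym/left_value_eq => //; exists (s - (x - d')); first by lra.
    by move=> s' ? ?; rewrite !dl//; lra.
  exists (Num.min d d'); first by rewrite lt_min d0.
  move=> t; rewrite lt_min ltr_norml => /andP[/andP[? ?]].
  rewrite ltr_norml => /andP[? ?] jt.
  have [tx|xt|//] := ltgtP t x.
    by case: (dl t) => //; lra.
  have [t0 []] := jt; apply/esym/left_value_eq => //.
  by exists (t - x); [lra|move=> s ? ?; rewrite !dr//; lra].
move=> /limit_pointP; have [d d0 dP] := iso l.
move=> [a_ [aJ al /cvgrPdist_lt /(_ _ d0) [N _ /(_ N (leqnn _)) /= aN]]].
have /aJ[jN _] : range a_ (a_ N) by exists N.
by have /eqP := al N; apply; exact: dP.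
Qed.

(** ** Transport by a time change *)

Lemma left_value_time_change (lam : R -> R) w w' (T : R) t : time_change lam ->
  (forall s, 0 <= s <= T -> w' s = w (lam s)) -> 0 < t -> t <= T ->
  left_value w' t = left_value w (lam t).
Proof.
move=> tl ww t0 tT; apply: left_value_eq => //.
have lt0 := time_change_gt0 tl t0.
have [d d0 dl] := left_valueP w lt0.
have a0 : 0 <= Num.max 0 (lam t - d) by rewrite le_max lexx.
have [a' a0' la] := time_change_surj tl a0.
have at' : a' < t by rewrite -(time_change_lt tl)// ?(ltW t0)// la gt_max lt0; lra.
exists (t - a'); first by lra.
move=> s sa st; have s0 : 0 <= s by lra.
rewrite ww ?s0//=; last by lra.
apply: dl; last by rewrite (time_change_lt tl)// ltW.
have : lam a' < lam s by rewrite (time_change_lt tl)//; lra.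
by rewrite la gt_max => /andP[].
Qed.

Lemma jumps_time_change (lam : R -> R) w w' (T : R) t : time_change lam ->
  (forall s, 0 <= s <= T -> w' s = w (lam s)) -> 0 <= t -> t <= T ->
  jumps w' t <-> jumps w (lam t).
Proof.
move=> tl ww; rewrite le_eqVlt => /predU1P[<- _|t0 tT].
  by rewrite time_change0//; split=> -[]; rewrite ltxx.
rewrite /jumps (left_value_time_change tl ww)// ww ?(ltW t0)//.
by split=> -[_ ?]; split=> //; exact: time_change_gt0.
Qed.

End StepPaths.

(** * Skorohod open sets *)

Section SkorohodOpen.
Variable R : realType.

Lemma skorohod_openE (W : uniformType) (U : set (cadlag R W)) :
  open U = skorohod_open U.
Proof. by []. Qed.

(** A nearby path takes nearby values at a nearby time; hence visiting an open
    set during a relatively open set of times is an open condition. *)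
Lemma open_visit (W : uniformType) (I : set R) (V : set W) : open V ->
  (forall s, I s -> 0 <= s) ->
  (forall s, I s -> exists2 d, 0 < d &
     forall s', 0 <= s' -> `|s' - s| < d -> I s') ->
  open [set w : cadlag R W | exists2 s, I s & V (w s)].
Proof.
move=> oV I0 Io; rewrite skorohod_openE => w [s Is Vs].
have [d d0 dI] := Io s Is.
have /nbhsP[E entE EV] : nbhs (w s) V by exact: open_nbhs_nbhs.
exists (s + d), d, (E^-1)%relation; split=> //.
move=> y [lam tl cl] /=.
have [|||s' [s'0 s'T ls s's]] := time_change_preimage (u := s) (T := s + d) tl d0.
- by move=> t /cl[].
- exact: I0.
- by [].
exists s'; first exact: dI.
apply: EV; apply/mem_set => /=; rewrite -ls.
by have [|_] := cl s'; first by rewrite s'0.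
Qed.

(** The value at t is recovered from the values right after t, which makes
    evaluation a countable intersection of open conditions. *)
Lemma measurable_evaluation (S : countType) (f : config S -> R) (t : R) :
  continuous f -> 0 <= t ->
  measurable_fun [set: borel (cadlag R (config S))]
    (fun w : cadlag R (config S) => f (w t)).
Proof.
move=> cf t0; apply: (measurability (@RGenCInfty.G R)).
  exact: RGenCInfty.measurableE.
move=> /= _ [_] [r] -> <-; rewrite setTI.
pose O n : set (cadlag R (config S)) := [set w | exists2 s, t < s < t + n.+1%:R^-1 &
  [set x | r - n.+1%:R^-1 < f x] (w s)].
have -> : (fun w : cadlag R (config S) => f (w t)) @^-1` `[r, +oo[ = \bigcap_n O n.
  apply/seteqP; split=> w /=.
  - rewrite in_itv /= andbT => rf n _.
    have [wr _] := path_of_cadlag w.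
    have /cvgrPdist_lt/(_ n.+1%:R^-1) : f (w s) @[s --> t^'+] --> f (w t).
      by apply: cvg_comp (wr t t0) (cf _).
    rewrite invr_gt0 ltr0n => /(_ isT)/near_at_rightP[d d0 dP].
    have n0 : 0 < n.+1%:R^-1 :> R by rewrite invr_gt0.
    have m0 : 0 < Num.min d n.+1%:R^-1 by rewrite lt_min d0.
    have [m1 m2] : Num.min d n.+1%:R^-1 <= d /\ Num.min d n.+1%:R^-1 <= n.+1%:R^-1.
      by rewrite !ge_min !lexx orbT.
    move: n0 m0 m1 m2 => /=.
    set h := n.+1%:R^-1; set m := Num.min d h => n0 m0 m1 m2.
    exists (t + m / 2); first by rewrite -/h; apply/andP; split; lra.
    have h1 : t < t + m / 2 by lra.
    have h2 : t + m / 2 < t + d by lra.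
    by have := dP _ h1 h2; rewrite -/h ltr_norml => /andP[? ?] /=; rewrite -/h; lra.
  - move=> wO; rewrite in_itv /= andbT leNgt; apply/negP => fr.
    have [k kr] := ltr_add_invr fr.
    have [wr _] := path_of_cadlag w.
    have : f (w s) @[s --> t^'+] --> f (w t).
      by apply: cvg_comp (wr t t0) (cf _).
    move=> /cvgrPdist_lt/(_ (r - k.+1%:R^-1 - f (w t))).
    rewrite subr_gt0 ltrBrDr => /(_ kr)/near_at_rightP[d d0 dP].
    have [m md] := ltr_add_invr d0; rewrite add0r in md.
    have [s /andP[ts stm]] := wO (maxn k m) I => /=.
    have le_inv (i j : nat) : (i <= j)%N -> j.+1%:R^-1 <= i.+1%:R^-1 :> R.
      by move=> ij; rewrite lef_pV2 ?posrE ?ltr0n// ler_nat.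
    have i1 := le_inv _ _ (leq_maxl k m); have i2 := le_inv _ _ (leq_maxr k m).
    have h2 : s < t + d by rewrite (lt_trans stm)// ltrD2l (le_lt_trans i2).
    have := dP _ ts h2; rewrite ltr_norml => /andP[lo _].
    move=> /= rfs; have : f (w s) < r - k.+1%:R^-1.
      by move: lo; rewrite opprB ltrD2l ltrN2.
    by rewrite ltNge; move/negP; apply; rewrite (le_trans _ (ltW rfs))// lerB.
apply: bigcapT_measurable => n; apply: sub_sigma_algebra.
apply: (@open_visit (config S) [set s | t < s < t + n.+1%:R^-1]
  [set x | r - n.+1%:R^-1 < f x]).
- by apply: (@open_comp _ _ f [set x | r - n.+1%:R^-1 < x]) => [x _|];
    [exact: cf|exact: open_gt].
- by move=> s /andP[/ltW/(le_trans t0)].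
- move: (n.+1%:R^-1) => h s /= /andP[ts st]; exists (Num.min (s - t) (t + h - s)).
    by rewrite lt_min; apply/andP; split; lra.
  move=> s' _; rewrite lt_min !ltr_norml => /andP[/andP[? ?] /andP[? ?]].
  by apply/andP; split; lra.
Qed.

(** Basic neighbourhoods of integer-valued paths: nearby integers are equal, so
    that nearby paths differ by a time change only. *)
Definition time_shifted (w : cadlag R nat) (T eps : R) : set (cadlag R nat) :=
  [set w' | exists2 lam, time_change lam &
    forall t, 0 <= t <= T -> `|lam t - t| < eps /\ w' t = w (lam t)].

Lemma entourage_nat_diagonal : entourage [set p : nat * nat | p.1 = p.2].
Proof. by rewrite uniform_discrete => _ [x _ <-]. Qed.

(** These sets need not be open, but those with a slightly larger T and a
    slightly smaller eps leave room for one more small time change. *)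
Lemma nbhs_time_shifted (w : cadlag R nat) (T eps : R) : 0 < eps ->
  nbhs w (time_shifted w T eps).
Proof.
move=> e0.
pose O : set (cadlag R nat) := [set y | exists T' eps',
  [/\ T < T', eps' < eps & time_shifted w T' eps' y]].
rewrite nbhsE; exists O; last first.
  move=> y [T' [eps' [TT ee [lam tl cl]]]]; exists lam => // t /andP[t0 tT].
  have [|] := cl t; first by rewrite t0 /= ltW// (le_lt_trans tT).
  by move=> /lt_trans/(_ ee).
split; last first.
  exists (T + 1), (eps / 2); split; [lra|lra|].
  exists id; first exact: time_change_id.
  by move=> t _; rewrite subrr normr0; split=> //; lra.
rewrite skorohod_openE => y [T' [eps' [TT ee [lam tl cl]]]].
pose eta := Num.min ((T' - T) / 2) ((eps - eps') / 2).
have eta0 : 0 < eta by rewrite lt_min; apply/andP; split; lra.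
have [eta1 eta2] : eta <= (T' - T) / 2 /\ eta <= (eps - eps') / 2.
  by rewrite !ge_min !lexx orbT.
exists ((T + T') / 2), eta, [set p : nat * nat | p.1 = p.2]; split=> //.
  exact: entourage_nat_diagonal.
move=> z [mu tm cm]; exists ((T + T') / 2), (eps' + eta); split; [lra|lra|].
exists (lam \o mu); first exact: time_change_comp.
move=> t /andP[t0 tT]; have [|/= mut ->] := cm t; first by rewrite t0.
have mu0 : 0 <= mu t by exact: time_change_ge0.
have [|lmu ->] := cl (mu t).
  by rewrite mu0 /=; move: mut; rewrite ltr_norml => /andP[? ?]; lra.
split=> //; rewrite (_ : _ - t = (lam (mu t) - mu t) + (mu t - t)); last by lra.
by rewrite (le_lt_trans (ler_normD _ _))// ltrD.
Qed.

Lemma closed_start0 : closed [set w : cadlag R nat | w 0 = 0%N].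
Proof.
rewrite -openC skorohod_openE => w /= w0; exists 1, 1, [set p : nat * nat | p.1 = p.2].
split=> //; first exact: entourage_nat_diagonal.
move=> y [lam tl /(_ 0)]; rewrite lexx ler01 => /(_ isT)[_] /= y0.
by rewrite /= y0 (time_change0 tl).
Qed.

(** The time bound is strict: a jump slightly after T may move to T in the
    limit. *)
Lemma closed_zero_before (T : R) :
  closed [set w : cadlag R nat | forall s, 0 <= s < T -> w s = 0%N].
Proof.
rewrite -openC.
have := @open_visit nat [set s | 0 <= s < T] [set n | n <> 0%N].
rewrite [X in open X -> _](_ : _ = ~` [set 0%N]); last by [].
set Y := (X in _ -> _ -> _ -> open X) => oY.
rewrite (_ : ~` _ = Y); last first.
  apply/seteqP; split=> w; first by move=> /existsNP[s /not_implyP[? ?]]; exists s.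
  by move=> [s sT ws] /(_ s sT).
apply: oY.
- exact: discrete_open.
- by move=> s /andP[].
- move=> s /andP[s0 sT]; exists (T - s); first by lra.
  by move=> s' s'0; rewrite ltr_norml => /andP[? ?] /=; rewrite s'0 /=; lra.
Qed.

(** A jump of another size is still present after a time change. *)
Lemma closed_unit_jumps :
  closed [set w : cadlag R nat | unit_jumps (fun s => (w s)%:R)].
Proof.
rewrite -openC skorohod_openE => w /= /unit_jumpsE/existsNP[t /not_implyP[jt wt]].
have [t0 _] := jt.
exists (t + 1), 1, [set p : nat * nat | p.1 = p.2].
split=> //; first exact: entourage_nat_diagonal.
move=> y [lam tl cl] /unit_jumpsE uy.
have [|||s [s0 sT ls _]] := time_change_preimage (u := t) (T := t + 1) tl ltr01.
- by move=> s /cl[].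
- exact: ltW.
- by [].
have yw u : 0 <= u <= t + 1 -> y u = w (lam u) by move=> /cl[].
have := uy s; rewrite (jumps_time_change tl yw)// ls => /(_ jt).
rewrite yw ?s0//= ls (left_value_time_change tl yw)// ?ls//.
rewrite lt0r s0 andbT; apply/eqP => se.
by move: ls t0; rewrite se (time_change0 tl) => <-; rewrite ltxx.
Qed.

End SkorohodOpen.

(** * Clock families without accumulation *)

Lemma nat_above (R : realType) (x : R) : exists n : nat, x < n%:R.
Proof.
exists (Num.bound `|x|).
by rewrite (le_lt_trans (ler_norm _))// archi_boundP.
Qed.

Section Clocks.
Variables (R : realType) (S : countType).
Implicit Types (K : clocks R S) (x : S) (t T : R) (A : {fset S}).
Implicit Types (B : {fset edge S}) (e : edge S).

Definition quiet A B T : set (clocks R S) :=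
  [set K | forall e, e \notin B -> (exists2 x, x \in A & x \in val e) ->
     forall s, 0 <= s < T -> K e s = 0%N].

(** The summability and regularity of the site counts amount to local
    finiteness: up to any time, all but finitely many of the clocks at a given
    site have not rung. *)
Definition locally_finite_clocks K : Prop :=
  [/\ forall e, unit_jumps (clock K e),
      forall e e', e != e' -> forall t, ~ (jumps (K e) t /\ jumps (K e') t),
      forall e, K e 0 = 0%N
    & forall x (n : nat), exists B, quiet [fset x]%fset B n%:R K].

Definition site_edges x B : {fset edge S} := [fset e in B | x \in val e]%fset.

Definition site_jumps K x t : Prop :=
  exists2 e : edge S, x \in val e & jumps (K e) t.

Lemma quiet_jumps A B T K e t : quiet A B T K -> jumps (K e) t -> t < T ->
  (exists2 x, x \in A & x \in val e) -> e \in B.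
Proof.
move=> qK [t0 jt] tT xe; apply: contrapT => /negP eB; apply: jt.
have z s : 0 <= s < T -> K e s = 0%N by apply: qK.
rewrite z ?(ltW t0)//; apply/esym/left_value_eq => //; exists t => // s ? ?.
by apply: z; apply/andP; split; lra.
Qed.

Lemma site_count_sum K x B T s : quiet [fset x]%fset B T K -> 0 <= s < T ->
  site_count K x s = (\sum_(e <- site_edges x B) K e s)%N%:R%:E.
Proof.
move=> qK sT; rewrite /site_count.
transitivity (\esum_(e in [set e : edge S | x \in val e] `&` [set` B])
    (clock K e s)%:E)%E.
  rewrite esum_mkcondr; apply: eq_esum => e /= xe; rewrite mem_setE.
  case: ifPn => // eB; rewrite /clock (qK e)//.
  by exists x => //; rewrite in_fset1.
rewrite (_ : _ `&` _ = [set` site_edges x B]); last first.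
  by apply/seteqP; split=> e /=; rewrite !inE /=;
    [move=> [-> ->]|move=> /andP[-> ->]].
rewrite esum_fset//; last by move=> e _; rewrite lee_fin ler0n.
by rewrite fsbig_finite//= set_fsetK sumEFin natr_sum.
Qed.

Section LocallyFinite.
Variables (K : clocks R S) (lfK : locally_finite_clocks K).

Lemma quiet_exists x T : exists B, quiet [fset x]%fset B T K.
Proof.
have [n Tn] := nat_above T; have [_ _ _ /(_ x n)[B qB]] := lfK.
exists B => e eB xe s /andP[s0 sT].
by apply: qB => //; rewrite s0 (lt_trans sT).
Qed.

(** At each time at most one of the finitely many relevant clocks rings, by one
    unit. *)
Lemma site_clock_left x t : 0 < t ->
  exists l : nat, site_clock K x s @[s --> t^'-] --> (l%:R : R) /\
    ((site_jumps K x t /\ site_clock K x t = l.+1%:R) \/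
     (~ site_jumps K x t /\ site_clock K x t = l%:R)).
Proof.
move=> t0; have [uK dK _ _] := lfK.
have [B qB] := quiet_exists x (t + 1).
have sE s : 0 <= s -> s < t + 1 ->
    site_clock K x s = (\sum_(e <- site_edges x B) K e s)%N%:R.
  by move=> s0 st; rewrite /site_clock (site_count_sum qB)// s0.
exists (\sum_(e <- site_edges x B) left_value (K e) t)%N; split.
  apply: cvg_near_cst.
  have nB : \forall s \near t^'-, forall e, e \in site_edges x B ->
      K e s = left_value (K e) t.
    apply: (@filter_bigI _ _ (site_edges x B)
      (fun e => [set s | K e s = left_value (K e) t])) => e _.
    by apply/near_at_leftP; exact: left_valueP.
  have npos : \forall s \near t^'-, 0 < s < t + 1.
    apply/near_at_leftP; exists t => // s ? ?.
    by apply/andP; split; lra.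
  near=> s.
  have /andP[s0 st] : 0 < s < t + 1 by near: s.
  rewrite sE ?ltW//; congr (_%:R); apply: eq_big_seq; near: s; exact: nB.
have tE : site_clock K x t = (\sum_(e <- site_edges x B) K e t)%N%:R.
  by rewrite sE ?ltW// ltrDl.
have [[e xe je]|nj] := pselect (site_jumps K x t); [left|right]; split=> //.
- by exists e.
- have eB : e \in site_edges x B.
    rewrite !inE /= xe andbT; apply: (quiet_jumps qB je); first by rewrite ltrDl.
    by exists x => //; rewrite in_fset1.
  rewrite tE !(bigD1_seq e eB) ?fset_uniq//=.
  rewrite ((unit_jumpsE (K e)).1 (uK e) t je) addSn; congr (_.+1%:R).
  congr addn; apply: eq_bigr => e' e'e.
  by apply: contrapT => ne; apply: (dK _ _ e'e t).
- rewrite tE; congr (_%:R); apply: eq_big_seq => e.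
  rewrite !inE => /andP[_ /= xe]; apply: contrapT => ne; apply: nj.
  by exists e.
Unshelve. all: by end_near. Qed.

Lemma site_jump_timeE x t : jump_time (site_clock K x) t <-> site_jumps K x t.
Proof.
split=> [[t0 nt]|[e xe je]].
  have [l [cl [[]//|[_ e]]]] := site_clock_left x t0.
  by case: nt; rewrite e.
have [t0 _] := je; split=> // ct.
have [l [cl [[_ e']|[nj _]]]] := site_clock_left x t0; last first.
  by case: nj; exists e.
have e2 : site_clock K x t = l%:R by exact: (norm_cvg_unique ct cl).
by move/eqP: e2; rewrite e' eqr_nat gtn_eqF.
Qed.

Lemma locally_finite_Gamma : Gamma K.
Proof.
have [uK dK K0 _] := lfK.
split=> //; last by move=> e e' /dK H t [/jump_timeE ? /jump_timeE ?]; exact: (H t).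
move=> x; split.
- move=> t t0; have [B qB] := quiet_exists x (t + 1).
  have tT : 0 <= t < t + 1 by rewrite t0 ltrDl ltr01.
  by rewrite (site_count_sum qB tT).
- split=> t t0; last by have [l [cl _]] := site_clock_left x t0; exists l%:R.
  have [B qB] := quiet_exists x (t + 1).
  have sE s : 0 <= s -> s < t + 1 ->
      site_clock K x s = (\sum_(e <- site_edges x B) K e s)%N%:R.
    by move=> s0 st; rewrite /site_clock (site_count_sum qB)// s0.
  apply: cvg_near_cst.
  have nB : \forall s \near t^'+, forall e, e \in site_edges x B -> K e s = K e t.
    apply: (@filter_bigI _ _ (site_edges x B)
      (fun e => [set s | K e s = K e t])) => e _.
    by apply/near_at_rightP; exact: cadlag_right.
  have npos : \forall s \near t^'+, t < s < t + 1.
    by apply/near_at_rightP; exists 1 => // s -> ->.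
  near=> s.
  have /andP[ts st] : t < s < t + 1 by near: s.
  rewrite !sE//; [|by lra|by lra]; congr (_%:R); apply: eq_big_seq; near: s; exact: nB.
- move=> t jt; have [t0 _] := jt; have /site_jump_timeE je := jt.
  have [l [cl [[_ ->]|[]//]]] := site_clock_left x t0.
  by rewrite -natr1 addrK.
Unshelve. all: by end_near. Qed.

Lemma finite_site_jumps x T : finite_set [set t | site_jumps K x t /\ t <= T].
Proof.
have [B qB] := quiet_exists x (T + 1).
apply: (@sub_finite_set _ _ (\bigcup_(e in [set` B]) [set t | jumps (K e) t /\ t <= T])).
  move=> t /= [[e xe je] tT]; exists e => //=; apply: (quiet_jumps qB je).
    by lra.
  by exists x => //; rewrite in_fset1.
by apply: bigcup_finite => // e _; exact: finite_jumps.
Qed.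

End LocallyFinite.

(** A finite sum of integers has finitely many nonzero terms, and a
    clock vanishing at time n has vanished before. *)
Lemma Gamma_locally_finite K : Gamma K -> locally_finite_clocks K.
Proof.
move=> [sK uK dK K0]; split=> //.
  by move=> e e' /dK H t [/jump_timeE ? /jump_timeE ?]; exact: (H t).
move=> x n; pose D : set (edge S) := [set e : edge S | x \in val e /\ K e n%:R != 0%N].
have finD : finite_set D.
  apply: contrapT => infD; have [/(_ n%:R (ler0n _ _)) fK _ _] := sK x.
  have [k ck] := nat_above (fine (site_count K x n%:R)).
  have [X XD kX] := infinite_set_fset k infD.
  have : ((#|` X|%fset)%:R%:E <= site_count K x n%:R)%E.
    apply: esum_ge; exists [set` X].
      by split=> // e /XD[].
    rewrite fsbig_finite//= set_fsetK sumEFin lee_fin -natr_sum ler_nat.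
    rewrite -sum1_size; rewrite big_seq [leqRHS]big_seq; apply: leq_sum => e eX.
    by have [_] := XD e eX; rewrite lt0n.
  rewrite -(fineK fK) lee_fin.
  by apply/negP; rewrite -ltNge (lt_le_trans ck)// ler_nat.
exists (fset_set D) => e eD [y]; rewrite in_fset1 => /eqP -> xe s /andP[s0 sn].
have /eqP Ken : K e n%:R == 0%N.
  by apply: contraNT eD => Ke; rewrite in_fset_set// inE.
by apply/eqP; rewrite -leqn0 -[leqRHS]Ken (unit_jumps_homo (uK e))// ltW.
Qed.

Lemma GammaE K : Gamma K <-> locally_finite_clocks K.
Proof. by split=> [/Gamma_locally_finite|/locally_finite_Gamma]. Qed.

End Clocks.

(** * Borel sets of clock families *)

Lemma countable_bigcapT_measurable d (T : measurableType d) (I : countType)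
  (F : I -> set T) : (forall i, measurable (F i)) -> measurable (\bigcap_i F i).
Proof.
move=> mF; rewrite -[X in measurable X]setCK setC_bigcap; apply: measurableC.
apply: countable_bigcupT_measurable; first exact: countableP.
by move=> i; exact: measurableC.
Qed.

Section ClockMeasurability.
Variables (R : realType) (S : countType).
Implicit Types (K : clocks R S) (A : {fset S}) (B : {fset edge S}).

Lemma near_clock K (e : edge S) (U : set (cadlag R nat)) :
  nbhs (K e) U -> \forall K' \near K, U (K' e).
Proof. exact: (@proj_continuous (edge S) (fun=> cadlag R nat) e K). Qed.

Lemma closed_clock (e : edge S) (F : set (cadlag R nat)) :
  closed F -> closed [set K : clocks R S | F (K e)].
Proof.
move=> cF; apply: (@closed_comp _ _ (fun K : clocks R S => K e) F) => // K _.
exact: (@proj_continuous (edge S) (fun=> cadlag R nat) e K).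
Qed.

Lemma measurable_closed (F : set (clocks R S)) :
  closed F -> measurable (F : set (borel (clocks R S))).
Proof.
move=> cF; rewrite -[F]setCK; apply: measurableC.
by apply: sub_sigma_algebra; exact: closed_openC.
Qed.

Lemma closed_quiet A B (T : R) : closed (quiet A B T : set (clocks R S)).
Proof.
rewrite (_ : quiet A B T = \bigcap_(e in [set e : edge S | e \notin B /\
    exists2 x, x \in A & x \in val e])
    [set K | forall s, 0 <= s < T -> K e s = 0%N]); last first.
  by apply/seteqP; split=> K H e; [move=> [eB xe]|move=> eB xe]; exact: H.
apply: closed_bigI => e _; exact: (closed_clock (e := e) (@closed_zero_before R T)).
Qed.

(** For two given clocks, absence of simultaneous jumps up to time n is stable
    under small perturbations as soon as there are none up to time n + 1: the
    finitely many jump times concerned are well separated. *)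
Lemma measurable_no_common_jump (e e' : edge S) :
  measurable ([set K : clocks R S | forall t, ~ (jumps (K e) t /\ jumps (K e') t)]
    : set (borel (clocks R S))).
Proof.
pose Z (n : nat) : set (clocks R S) :=
  [set K | forall t, t <= n%:R -> ~ (jumps (K e) t /\ jumps (K e') t)].
rewrite (_ : mkset _ = \bigcap_n (Z n)°); last first.
  apply/seteqP; split=> K /=; last first.
    move=> ZK t; have [n tn] := nat_above t.
    by have /interior_subset/(_ t (ltW tn)) := ZK n I.
  move=> NC n _; rewrite /interior.
  pose D := [set t | jumps (K e) t /\ t <= n%:R + 1] `|`
            [set t | jumps (K e') t /\ t <= n%:R + 1].
  have finD : finite_set D by rewrite finite_setU; split; exact: finite_jumps.
  have [d d0 sepD] := finite_separated finD.
  have m0 : 0 < Num.min (d / 2) 1 by rewrite lt_min; apply/andP; split; lra.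
  have [m1 m2] : Num.min (d / 2) 1 <= d / 2 /\ Num.min (d / 2) 1 <= 1.
    by rewrite !ge_min !lexx orbT.
  move: m0 m1 m2; set m := Num.min _ _ => m0 m1 m2.
  have n1 := near_clock (nbhs_time_shifted (K e) n%:R m0).
  have n2 := near_clock (nbhs_time_shifted (K e') n%:R m0).
  near=> K' => t tn [je je'].
  have [lam tl cl] : time_shifted (K e) n%:R m (K' e) by near: K'.
  have [mu tm cm] : time_shifted (K e') n%:R m (K' e') by near: K'.
  have [t0 _] := je; have t0n : 0 <= t <= n%:R by rewrite ltW.
  have [] := cl t t0n; rewrite ltr_norml => /andP[l1 l2] _.
  have [] := cm t t0n; rewrite ltr_norml => /andP[u1 u2] _.
  have jl : jumps (K e) (lam t).
    by apply/(jumps_time_change tl (w' := K' e) (T := n%:R)) => //;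
      [move=> s /cl[]|exact: ltW].
  have jm : jumps (K e') (mu t).
    by apply/(jumps_time_change tm (w' := K' e') (T := n%:R)) => //;
      [move=> s /cm[]|exact: ltW].
  have Dl : D (lam t) by left; split=> //; lra.
  have Dm : D (mu t) by right; split=> //; lra.
  have [/(sepD _ _ Dl Dm)|/(sepD _ _ Dm Dl)|lm] := ltgtP (lam t) (mu t); try lra.
  by apply: (NC (lam t)); split=> //; rewrite lm.
apply: bigcapT_measurable => n; apply: sub_sigma_algebra; exact: open_interior.
Unshelve. all: by end_near. Qed.

Lemma measurable_Gamma : measurable (@Gamma R S : set (borel (clocks R S))).
Proof.
rewrite (_ : @Gamma R S =
  ((\bigcap_(e in [set: edge S]) [set K : clocks R S | unit_jumps (clock K e)]) `&`
  (\bigcap_(p in [set: edge S * edge S]) (if p.1 == p.2 then setT else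
    [set K : clocks R S | forall t, ~ (jumps (K p.1) t /\ jumps (K p.2) t)]))) `&`
  ((\bigcap_(e in [set: edge S]) [set K : clocks R S | K e 0 = 0%N]) `&`
  (\bigcap_(p in [set: S * nat]) \bigcup_(B in [set: {fset edge S}])
    (quiet [fset p.1]%fset B p.2%:R : set (clocks R S))))); last first.
  apply/seteqP; split=> K.
    move=> /GammaE[uK dK K0 qK]; split; split.
    - by move=> e _; exact: uK.
    - by move=> [e e'] _ /=; case: eqP => // /eqP; exact: dK.
    - by move=> e _; exact: K0.
    - by move=> [x n] _; have [B] := qK x n; exists B.
  move=> [[uK dK] [K0 qK]]; apply/GammaE; split.
  - by move=> e; exact: uK.
  - by move=> e e' /negbTE ee'; have := dK (e, e') I; rewrite /= ee'.
  - by move=> e; exact: K0.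
  - by move=> x n; have [B _ ?] := qK (x, n) I; exists B.
apply: measurableI; apply: measurableI.
- apply: countable_bigcapT_measurable => e.
  by apply: measurable_closed; exact: (closed_clock (e := e) (@closed_unit_jumps R)).
- apply: countable_bigcapT_measurable => p.
  by case: ifPn => // _; exact: measurable_no_common_jump.
- apply: countable_bigcapT_measurable => e.
  by apply: measurable_closed; exact: (closed_clock (e := e) (@closed_start0 R)).
- apply: countable_bigcapT_measurable => p.
  apply: countable_bigcupT_measurable => [|B]; first exact: countableP.
  by apply: measurable_closed; exact: closed_quiet.
Qed.

(** The graphical construction is not continuous, because arbitrarily distant
    clocks may ring early, but it becomes so once all but finitely many of the
    clocks around a finite set of sites are kept silent up to some time.  The
    corresponding closed sets form a countable family, so that local conditions
    relative to them are Borel. *)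
Definition quietly_near (Z : set (clocks R S)) : set (clocks R S) :=
  [set K | exists A B (n : nat), quiet A B n%:R K /\
    \forall K' \near K, quiet A B n%:R K' -> Gamma K' -> Z K'].

Lemma measurable_quietly_near (Z : set (clocks R S)) :
  measurable (@Gamma R S `&` quietly_near Z : set (borel (clocks R S))).
Proof.
rewrite (_ : quietly_near Z = \bigcup_(j in [set: {fset S} * {fset edge S} * nat])
    ((quiet j.1.1 j.1.2 j.2%:R : set (clocks R S)) `&`
     [set K' | quiet j.1.1 j.1.2 j.2%:R K' -> Gamma K' -> Z K']°)); last first.
  apply/seteqP; split=> K.
    by move=> [A [B [n [qK nK]]]]; exists (A, B, n).
  by move=> [[[A B] n] _ [qK nK]]; exists A, B, n.
apply: measurableI; first exact: measurable_Gamma.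
apply: countable_bigcupT_measurable => [|j]; first exact: countableP.
apply: measurableI; first by apply: measurable_closed; exact: closed_quiet.
apply: sub_sigma_algebra; exact: open_interior.
Qed.

Lemma quietly_near_sub (Z : set (clocks R S)) K :
  Gamma K -> quietly_near Z K -> Z K.
Proof.
by move=> GK [A [B [n [qK /nbhs_singleton]]]]; exact.
Qed.

End ClockMeasurability.

(** * The backward algorithm *)

Lemma fset_uniform (I : eqType) (U : choiceType) (s : seq I)
    (P : I -> {fset U} -> Prop) :
  (forall i (A A' : {fset U}), (A `<=` A')%fset -> P i A -> P i A') ->
  (forall i, i \in s -> exists A, P i A) ->
  exists A, forall i, i \in s -> P i A.
Proof.
move=> mono; elim: s => [|i s IH] H; first by exists fset0.
have [|A PA] := IH; first by move=> j js; apply: H; rewrite in_cons js orbT.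
have [A' PA'] := H i (mem_head _ _).
exists (A `|` A')%fset => j; rewrite in_cons => /predU1P[->|/PA].
  by apply: mono PA'; exact: fsubsetUr.
by apply: mono; exact: fsubsetUl.
Qed.

Section Backtracking.
Variables (R : realType) (S : countType).
Implicit Types (K : clocks R S) (x y : S) (t T : R) (I : set R).
Implicit Types (A F : {fset S}) (e : edge S).

(** The sites visited by the algorithm are recorded, because only the clocks
    around them matter. *)
Inductive backtrack_in K A : set R -> S -> S -> Prop :=
| backtrack_in_stop I x : x \in A ->
    (forall s, I s -> ~ site_jumps K x s) -> backtrack_in K A I x x
| backtrack_in_jump I x s e x1 y : x \in A -> I s -> jumps (K e) s ->
    val e = [fset x; x1]%fset ->
    (forall u, I u -> site_jumps K x u -> u <= s) ->
    backtrack_in K A `[0, s[ x1 y -> backtrack_in K A I x y.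

Lemma backtrack_in_sub K A A' I x y : (A `<=` A')%fset ->
  backtrack_in K A I x y -> backtrack_in K A' I x y.
Proof.
move=> /fsubsetP AA'; elim=> {I x y} [I x xA nj|I x s e x1 y xA Is je ve ms _ IH].
  by apply: backtrack_in_stop => //; exact: AA'.
by apply: (@backtrack_in_jump K A' I x s e x1 y) => //; exact: AA'.
Qed.

Lemma backtrack_in_eq K A I I' x y :
  (forall s, site_jumps K x s -> (I s <-> I' s)) ->
  backtrack_in K A I x y -> backtrack_in K A I' x y.
Proof.
move=> II' b; case: b II' => {I x y} [I x xA nj|I x s e x1 y xA Is je ve ms b] II'.
  by apply: backtrack_in_stop => // s I's js; apply: (nj s) => //; exact/II'.
apply: (@backtrack_in_jump K A I' x s e x1 y) => //.
- by apply/II' => //; exists e => //; rewrite ve !inE eqxx.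
- by move=> u I'u ju; apply: ms => //; exact/II'.
Qed.

Lemma backtrack_in_last K A I x y : backtrack_in K A I x y ->
  (forall s, I s -> ~ site_jumps K x s) \/
  exists s, [/\ I s, site_jumps K x s & forall u, I u -> site_jumps K x u -> u <= s].
Proof.
case=> {I x y} [I x _ nj|I x s e x1 y _ Is je ve ms _]; first by left.
by right; exists s; split=> //; exists e => //; rewrite ve !inE eqxx.
Qed.

Lemma backtrackP K I x y : Gamma K ->
  backtrack K I x y <-> exists A, backtrack_in K A I x y.
Proof.
move=> GK; have lfK := Gamma_locally_finite GK.
split=> [|[A]]; elim=> {I x y}.
- move=> I x nj; exists [fset x]%fset.
  apply: backtrack_in_stop; first by rewrite in_fset1.
  by move=> s Is /(site_jump_timeE lfK); exact: nj.
- move=> I x s e x1 y [Is js ms] ve /jump_timeE je _ [A b].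
  exists (x |` A)%fset; apply: (@backtrack_in_jump K _ I x s e x1 y) => //.
  + by rewrite !inE eqxx.
  + by move=> u Iu /(site_jump_timeE lfK); exact: ms.
  + by apply: backtrack_in_sub b; exact: fsubsetUr.
- move=> I x _ nj; apply: backtrack_stop => s Is /(site_jump_timeE lfK).
  exact: nj.
- move=> I x s e x1 y _ Is je ve ms _ b.
  apply: (@backtrack_jump _ _ K I x s e x1 y) => //; last exact/jump_timeE.
  split=> //.
    by apply/(site_jump_timeE lfK); exists e => //; rewrite ve !inE eqxx.
  by move=> u Iu /(site_jump_timeE lfK); exact: ms.
Qed.

Lemma edge_neighbor e x y y' :
  val e = [fset x; y]%fset -> val e = [fset x; y']%fset -> y = y'.
Proof.
move=> ey ey'; have /eqP := valP e; rewrite ey cardfs2.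
case: eqVneq => //= xy _; have : y \in [fset x; y']%fset.
  by rewrite -ey' ey !inE eqxx orbT.
by rewrite !inE eq_sym (negbTE xy) => /eqP.
Qed.

Lemma backtrack_in_fun K A A' I x y y' : Gamma K ->
  backtrack_in K A I x y -> backtrack_in K A' I x y' -> y = y'.
Proof.
move=> /Gamma_locally_finite[_ dK _ _] b; elim: b A' y' => {I x y}.
- move=> I x _ nj A' y' b'; case: b' nj => // {}I {}x s e x1 y _ Is je ve _ _ nj.
  by case: (nj s Is); exists e => //; rewrite ve !inE eqxx.
- move=> I x s e x1 y _ Is je ve ms _ IH A' y' b'.
  case: b' Is je ve ms => {I x y'}.
    move=> I x _ nj Is je ve _; case: (nj s Is).
    by exists e => //; rewrite ve !inE eqxx.
  move=> I x s' e' x1' y' _ Is' je' ve' ms' b' Is je ve ms.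
  have ss' : s = s'.
    apply/eqP; rewrite eq_le ms'//=; last by exists e => //; rewrite ve !inE eqxx.
    by apply: ms => //; exists e' => //; rewrite ve' !inE eqxx.
  subst s'; have ee' : e = e'.
    by apply: contrapT => /eqP /dK /(_ s); apply.
  subst e'; have xx' := edge_neighbor ve ve'; subst x1'.
  exact: IH b'.
Qed.

Lemma backward_site_Some K A t x y : Gamma K ->
  backtrack_in K A `[0, t] x y -> backward_site K t x = Some y.
Proof.
move=> GK b; rewrite /backward_site; case: xgetP => [z -> [y' b' <-]|/(_ (Some y))].
  by move/(backtrackP _ _ _ GK) : b' => [A' b']; rewrite (backtrack_in_fun GK b b').
by case; exists y => //; apply/(backtrackP _ _ _ GK); exists A.
Qed.

Lemma backward_site_exists K t x : Gamma K -> backward_site K t x != None ->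
  exists A y, backtrack_in K A `[0, t] x y.
Proof.
move=> GK; rewrite /backward_site; case: xgetP => [z -> [y b <-] _|//].
by move/(backtrackP _ _ _ GK) : b => [A b]; exists A, y.
Qed.

(** The algorithm only looks at the last jump before t, and there are finitely
    many candidates up to time T, each leading to a finite path. *)
Lemma backtrack_in_uniform K x T : Gamma K ->
  (forall t, 0 <= t -> backward_site K t x != None) ->
  exists A, forall t, 0 <= t <= T -> exists y, backtrack_in K A `[0, t] x y.
Proof.
move=> GK ex; have lfK := Gamma_locally_finite GK.
have [l lE] : exists l : seq R, [set t | site_jumps K x t /\ t <= T] = [set` l].
  by apply/finite_seqP; exact: finite_site_jumps.
have [||A PA] := @fset_uniform R S l
    (fun t A => exists y, backtrack_in K A `[0, t] x y).
- by move=> t A A' AA' [y b]; exists y; exact: backtrack_in_sub b.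
- move=> t tl; have [jt _] : [set t | site_jumps K x t /\ t <= T] t by rewrite lE.
  have [e _ [t0 _]] := jt.
  by apply: (backward_site_exists GK); apply: ex; exact: ltW.
exists (x |` A)%fset => t /andP[t0 tT].
have [A' [y b]] := backward_site_exists GK (ex t t0).
have xA : x \in (x |` A)%fset by rewrite !inE eqxx.
have [nj|[s [Is js ms]]] := backtrack_in_last b.
  by exists x; apply: backtrack_in_stop.
have [s0 sT] : 0 <= s /\ s <= T.
  by move: Is; rewrite /= in_itv /= => /andP[s0 st]; split=> //; exact: le_trans tT.
have /PA[z bz] : s \in l.
  by have : [set t | site_jumps K x t /\ t <= T] s by []; rewrite lE.
exists z; apply: (@backtrack_in_eq K _ `[0, s]); last first.
  by apply: backtrack_in_sub bz; exact: fsubsetUr.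
move=> u ju; rewrite /= !in_itv /=; split=> /andP[u0 us]; rewrite u0 /=.
  by move: Is; rewrite /= in_itv /= => /andP[_]; exact: le_trans.
by apply: ms => //; rewrite /= in_itv /= u0.
Qed.

(** * Stability of the backward algorithm *)

(** The clocks around A ring at corresponding times for K' and K, so that the
    two runs of the algorithm make the same choices as long as they stay in
    A. *)
Lemma backtrack_in_time_change K K' A (lam : R -> R) (T : R) I I' x y :
  time_change lam ->
  (forall e s, (exists2 x, x \in A & x \in val e) -> 0 <= s -> s <= T ->
     (jumps (K' e) s <-> jumps (K e) (lam s))) ->
  (forall s, 0 <= s -> (I' s <-> I (lam s))) -> (forall s, I' s -> s <= T) ->
  backtrack_in K A I x y -> backtrack_in K' A I' x y.
Proof.
move=> tl KK' + + b; elim: b I' => {I x y}.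
- move=> I x xA nj I' II' I'T; apply: backtrack_in_stop => // s I's [e xe je].
  have [s0 _] := je; apply: (nj (lam s)); first by apply/II' => //; exact: ltW.
  by exists e => //; apply/KK' => //; [exists x|exact: ltW|exact: I'T].
- move=> I x s e x1 y xA Is je ve ms _ IH I' II' I'T.
  have xe : x \in val e by rewrite ve !inE eqxx.
  have [s0 _] := je; have [s' s'0 ls] := time_change_surj tl (ltW s0).
  have I's : I' s' by apply/II' => //; rewrite ls.
  apply: (@backtrack_in_jump K' A I' x s' e x1 y) => //.
  + by apply/KK' => //; [exists x|exact: I'T|rewrite ls].
  + move=> u I'u [e' xe' je']; have [u0 _] := je'.
    rewrite -(time_change_le tl (ltW u0) s'0) ls; apply: ms.
      by apply/II' => //; exact: ltW.
    by exists e' => //; apply/KK' => //; [exists x|exact: ltW|exact: I'T].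
  + apply: IH => [u u0|u]; rewrite /= !in_itv /=; last first.
      by move=> /andP[_ /ltW us]; apply: le_trans us _; exact: I'T.
    by rewrite u0 (time_change_ge0 tl u0) -ls (time_change_lt tl).
Qed.

(** Near K, the jump times of the finitely many clocks which matter up to time
    T are moved a little, each clock by a time change of its own.  Jump times
    of K being well separated, their order is preserved, and one single time
    change interpolates between the jump times of K and those of K'. *)
Lemma common_time_change K A (B : {fset edge S}) (n : nat) (T eps : R) :
  Gamma K -> quiet A B n%:R K -> T + 2 <= n%:R -> 0 < eps -> eps <= 1 ->
  \forall K' \near K, quiet A B n%:R K' -> exists lam, [/\ time_change lam,
    forall t, 0 <= t -> `|lam t - t| < eps &
    forall e s, (exists2 x, x \in A & x \in val e) -> 0 <= s -> s <= T ->
      (jumps (K' e) s <-> jumps (K e) (lam s))].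
Proof.
move=> GK qK Tn e0 e1; have [_ dK _ _] := Gamma_locally_finite GK.
(* The bound n - 1 ensures that the corresponding jump times of K', which are
   at distance less than 1, lie before time n. *)
pose D : set R := \bigcup_(e in [set` B]) [set t | jumps (K e) t /\ t <= n%:R - 1].
have finD : finite_set D by apply: bigcup_finite => // e _; exact: finite_jumps.
have [d d0 sepD] := finite_separated finD.
(* Moving points at distance d by less than d / 2 preserves their order. *)
pose m := Num.min (d / 2) eps.
have m0 : 0 < m by rewrite lt_min; apply/andP; split; lra.
have [m1 m2] : m <= d / 2 /\ m <= eps by rewrite !ge_min !lexx orbT.
have nB : \forall K' \near K, forall e, e \in B ->
    time_shifted (K e) n%:R m (K' e).
  apply: (@filter_bigI _ _ B (fun e => [set K' : clocks R S |
    time_shifted (K e) n%:R m (K' e)])) => e _.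
  exact: near_clock (nbhs_time_shifted (K e) n%:R m0).
near=> K' => qK'.
have hB : forall e, e \in B -> time_shifted (K e) n%:R m (K' e) by near: K'.
have /choice[lam_ lamP] : forall e, exists lam, e \in B -> time_change lam /\
    forall t, 0 <= t <= n%:R -> `|lam t - t| < m /\ K' e t = K e (lam t).
  by move=> e; have [/hB[lam]|_] := boolP (e \in B); [exists lam|exists id].
have lam_cl e : e \in B -> forall t, 0 <= t <= n%:R -> `|lam_ e t - t| < m.
  by move=> /lamP[_ cl] t /cl[].
have lamK e : e \in B -> forall t, 0 <= t <= n%:R -> K' e t = K e (lam_ e t).
  by move=> /lamP[_ cl] t /cl[].
have /choice[g gP] : forall s, exists s', forall e, e \in B -> jumps (K e) s ->
    s <= n%:R - 1 -> [/\ 0 <= s', s' <= n%:R, lam_ e s' = s & `|s' - s| < m].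
  move=> s; have [[e [eB je sn]]|nj] := pselect (exists e,
      [/\ e \in B, jumps (K e) s & s <= n%:R - 1]); last first.
    by exists 0 => e eB je sn; case: nj; exists e.
  have [tl _] := lamP e eB; have [s0 _] := je.
  have [|s' s'P] := time_change_preimage (u := s) tl m0 (lam_cl e eB) (ltW s0).
    by lra.
  exists s' => e' _ je' _; have [<-//|/eqP ee'] := pselect (e = e').
  by case: (dK _ _ ee' s).
have gD s : D s -> exists e, [/\ e \in B, jumps (K e) s, s <= n%:R - 1 &
    [/\ 0 <= g s, g s <= n%:R, lam_ e (g s) = s & `|g s - s| < m]].
  by move=> [e eB [je sn]]; exists e; split=> //; exact: gP.
have [||||lam [tl il cl]] := time_change_interpolation (D := D) (g := g) m0 finD.
- by move=> s [e _ [[]]].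
- move=> s /gD[e [eB [s0 _] _ [gs0 _ ls _]]]; have [tle _] := lamP e eB.
  rewrite lt0r gs0 andbT; apply/eqP => g0.
  by move: s0; rewrite -ls g0 (time_change0 tle) ltxx.
- move=> s t Ds Dt st; have := sepD _ _ Ds Dt st.
  have [e [_ _ _ [_ _ _]]] := gD s Ds; rewrite ltr_norml => /andP[? ?].
  by have [e' [_ _ _ [_ _ _]]] := gD t Dt; rewrite ltr_norml => /andP[? ?]; lra.
- by move=> s /gD[e [_ _ _ []]].
exists lam; split=> // [t t0|e s xe s0 sT].
  by rewrite (lt_le_trans (cl t t0)).
have ls : lam s <= s + m by have := cl s s0; rewrite ltr_norml => /andP[_]; lra.
have [eB|eB] := boolP (e \in B); last first.
  by split=> j; have := quiet_jumps _ j _ xe;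
    [move=> /(_ _ _ qK')|move=> /(_ _ _ qK)];
    rewrite (negbTE eB) => /(_ ltac:(lra)).
have [tle _] := lamP e eB.
have sn : 0 <= s <= n%:R by rewrite s0 /=; lra.
have jE := jumps_time_change tle (lamK e eB) s0 (_ : s <= n%:R).
have {}jE : jumps (K' e) s <-> jumps (K e) (lam_ e s) by apply: jE; lra.
split=> j.
- have {}j := jE.1 j.
  have len : lam_ e s <= n%:R - 1.
    by have := lam_cl e eB s sn; rewrite ltr_norml => /andP[_]; lra.
  have [g0 _ lg _] := gP _ e eB j len.
  have <- : lam (g (lam_ e s)) = lam s.
    by congr lam; exact: (time_change_inj tle).
  by rewrite il//; exists e.
- have len : lam s <= n%:R - 1 by lra.
  have [g0 _ lg _] := gP _ e eB j len.
  have gs : g (lam s) = s.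
    by apply: (time_change_inj tl) => //; rewrite il//; exists e.
  by apply/jE; rewrite -gs lg.
Unshelve. all: by end_near. Qed.

(** The set A contains the sites visited from F, and B the clocks around A
    which ring before time n. *)
Lemma backward_site_stable K F (T eps : R) : Gamma_star K -> 0 < eps ->
  quietly_near [set K' | exists2 lam, time_change lam & forall t, 0 <= t <= T ->
    `|lam t - t| < eps /\ forall x, x \in F -> exists y,
      backward_site K' t x = Some y /\ backward_site K (lam t) x = Some y] K.
Proof.
move=> [GK exK] e0; have lfK := Gamma_locally_finite GK.
have [n Tn] := nat_above (T + 2).
have [||A PA] := @fset_uniform S S F (fun x A => forall t, 0 <= t <= n%:R ->
    exists y, backtrack_in K A `[0, t] x y).
- by move=> x A A' AA' b t /b[y /(backtrack_in_sub AA')]; exists y.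
- by move=> x _; apply: backtrack_in_uniform => // t; exact: exK.
have [||B PB] := @fset_uniform S (edge S) A
    (fun x B => quiet [fset x]%fset B n%:R K).
- move=> x B B' /fsubsetP BB' qB e eB'; apply: qB; apply: contra eB'; exact: BB'.
- by move=> x _; exact: quiet_exists.
have qK : quiet A B n%:R K.
  move=> e eB [x xA xe]; apply: (PB x xA e eB); exists x => //.
  by rewrite in_fset1.
exists A, B, n; split=> //.
pose m := Num.min eps 1.
have m0 : 0 < m by rewrite lt_min e0 ltr01.
have [m1 m2] : m <= eps /\ m <= 1 by rewrite !ge_min !lexx orbT.
have near_lam := common_time_change GK qK (ltW Tn) m0 m2.
near=> K' => qK' GK'.
have [lam [tl cl KK']] : exists lam, [/\ time_change lam,
    forall t, 0 <= t -> `|lam t - t| < m &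
    forall e s, (exists2 x, x \in A & x \in val e) -> 0 <= s -> s <= T ->
      (jumps (K' e) s <-> jumps (K e) (lam s))].
  by move: qK'; near: K'.
exists lam => // t /andP[t0 tT]; split; first by rewrite (lt_le_trans (cl t t0)).
move=> x xF; have [|y b] := PA x xF (lam t).
  rewrite (time_change_ge0 tl t0) /=.
  by have := cl t t0; rewrite ltr_norml => /andP[_]; lra.
exists y; split; last exact: backward_site_Some b.
apply: (@backward_site_Some _ A _ _ _ GK').
apply: (backtrack_in_time_change tl KK' _ _ b).
- move=> s s0; rewrite /= !in_itv /= s0 (time_change_ge0 tl s0).
  by rewrite (time_change_le tl).
- by move=> s; rewrite /= in_itv /= => /andP[_ /le_trans]; exact.
Unshelve. all: by end_near. Qed.

End Backtracking.

(** * The exclusion path as a measurable function of the clocks *)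

Section ExclusionPath.
Variables (R : realType) (S : countType).
Implicit Types (K : clocks R S) (x : S) (t T : R) (sigma tau : config S).

Lemma quietly_nearS (Z Z' : set (clocks R S)) :
  Z `<=` Z' -> quietly_near Z `<=` quietly_near Z'.
Proof.
move=> ZZ' K [A [B [n [qK nK]]]]; exists A, B, n; split=> //.
by apply: filterS nK => K' H qK' GK'; apply/ZZ'/H.
Qed.

(** By stability, reaching a site for all times up to n is a condition which
    holds near every point of Gamma_star relative to a quiet set. *)
Lemma measurable_Gamma_star :
  measurable (@Gamma_star R S : set (borel (clocks R S))).
Proof.
rewrite (_ : @Gamma_star R S = \bigcap_(p in [set: S * nat])
    (@Gamma R S `&` quietly_near [set K | forall t, 0 <= t <= p.2%:R ->
      backward_site K t p.1 != None]) `&` @Gamma R S); last first.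
  apply/seteqP; split=> K [].
  - move=> GK exK; split=> // -[x n] _; split=> //.
    have sK := backward_site_stable [fset x]%fset n%:R (conj GK exK) ltr01.
    apply: quietly_nearS sK => K' [lam tl cl] t /cl[_ /(_ x)].
    by rewrite in_fset1 eqxx => /(_ isT)[y [-> _]].
  - move=> H GK; split=> // x t t0; have [n /ltW tn] := nat_above t.
    have [_ /(quietly_near_sub GK)] := H (x, n) I.
    by apply; rewrite t0.
apply: measurableI; last exact: measurable_Gamma.
by apply: countable_bigcapT_measurable => p; exact: measurable_quietly_near.
Qed.

Lemma backward_site_eq K x t u : Gamma_star K -> 0 <= t -> 0 <= u ->
  (forall s, site_jumps K x s -> (s <= t <-> s <= u)) ->
  backward_site K t x = backward_site K u x.
Proof.
move=> [GK exK] t0 u0 tu.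
have [A [y b]] := backward_site_exists GK (exK x t t0).
rewrite (backward_site_Some GK b); apply/esym/(backward_site_Some GK).
apply: backtrack_in_eq b => s js; rewrite /= !in_itv /=.
by split=> /andP[-> st] /=; apply/tu.
Qed.

(** The algorithm only changes its outcome at the locally finitely many jump
    times of the clocks at x. *)
Lemma backward_site_right K x t : Gamma_star K -> 0 <= t ->
  \forall u \near t^'+, backward_site K u x = backward_site K t x.
Proof.
move=> GK t0; have lfK := Gamma_locally_finite GK.1.
have finD : finite_set (t |` [set s | site_jumps K x s /\ s <= t + 1]).
  by rewrite finite_setU; split; [exact: finite_set1|exact: finite_site_jumps].
have [d d0 dP] := finite_separated finD.
have m0 : 0 < Num.min d 1 by rewrite lt_min d0 ltr01.
have [m1 m2] : Num.min d 1 <= d /\ Num.min d 1 <= 1 by rewrite !ge_min !lexx orbT.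
apply/near_at_rightP; exists (Num.min d 1) => // u tu ud.
apply: backward_site_eq => //; first by lra.
move=> s js; split=> [su|]; last by lra.
rewrite leNgt; apply/negP => ts.
have := dP t s (or_introl erefl) (or_intror (conj js _)) ts; lra.
Qed.

Lemma backward_site_left K x t : Gamma_star K -> 0 < t ->
  exists o, \forall u \near t^'-, backward_site K u x = o.
Proof.
move=> GK t0; have lfK := Gamma_locally_finite GK.1.
have finD : finite_set (t |` [set s | site_jumps K x s /\ s <= t]).
  by rewrite finite_setU; split; [exact: finite_set1|exact: finite_site_jumps].
have [d d0 dP] := finite_separated finD.
have m0 : 0 < Num.min d t by rewrite lt_min d0 t0.
have [m1 m2] : Num.min d t <= d /\ Num.min d t <= t by rewrite !ge_min !lexx orbT.
move: m0 m1 m2; set m := Num.min d t => m0 m1 m2.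
exists (backward_site K (t - m / 2) x).
apply/near_at_leftP; exists m => // u ut tu.
apply: backward_site_eq => //; [lra|lra|].
move=> s js; split=> [su|st].
- have st : s < t by lra.
  have := dP s t (or_intror (conj js (ltW st))) (or_introl erefl) st; lra.
- have st' : s < t by lra.
  have := dP s t (or_intror (conj js (ltW st'))) (or_introl erefl) st'; lra.
Qed.

Lemma cvg_config (T : Type) (F : set_system T) (w : T -> config S) sigma :
  Filter F -> (forall x, \forall s \near F, w s x = sigma x) -> w @ F --> sigma.
Proof.
move=> FF wx; apply/cvg_sup => x U [_ [[W oW <-] Wx] WU].
by apply: filterS (wx x) => s ws; apply: WU; rewrite /= ws.
Qed.

Lemma cadlag_ext (W : topologicalType) (w w' : cadlag R W) :
  (forall t, 0 <= t -> w t = w' t) -> w = w'.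
Proof.
case: w w' => [w cw nw] [w' cw' nw'] /= ww'.
have e : w = w'.
  apply/funext => t; have [/ww'//|t0] := leP 0 t.
  by rewrite nw// nw'// ww'.
by subst w'; congr Cadlag; exact: Prop_irrelevance.
Qed.

Lemma exclusion_cadlag K sigma : Gamma_star K ->
  exists w : cadlag R (config S), forall t, 0 <= t -> w t = eta K sigma t.
Proof.
move=> GK; pose w t := eta K sigma (Num.max 0 t).
have cw : is_cadlag w.
  split=> t t0.
  - apply: cvg_config => x.
    have tpos : \forall u \near t^'+, 0 <= u.
      by apply/near_at_rightP; exists 1 => // u tu _; lra.
    have := backward_site_right x GK t0; move: tpos; apply: filterS2 => u u0 eu.
    by rewrite /w /eta !max_r// eu.
  - have [lv lvP] := choice (fun x => backward_site_left x GK t0).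
    exists (fun x => if lv x is Some y then sigma y else false).
    apply: cvg_config => x.
    have tpos : \forall u \near t^'-, 0 <= u.
      by apply/near_at_leftP; exists t => // u; lra.
    have := lvP x; move: tpos; apply: filterS2 => u u0 eu.
    by rewrite /w /eta max_r// eu.
have nw s : s < 0 -> w s = w 0 by move=> s0; rewrite /w maxxx max_l// ltW.
by exists (Cadlag cw nw) => t t0; rewrite /= /w max_r.
Qed.

(** Constant off Gamma_star, hence measurable on the whole space. *)
Definition exclusion_path sigma K : cadlag R (config S) :=
  xget (point : cadlag R (config S))
    [set w | Gamma_star K /\ forall t, 0 <= t -> w t = eta K sigma t].

Lemma exclusion_pathE sigma K t : Gamma_star K -> 0 <= t ->
  exclusion_path sigma K t = eta K sigma t.
Proof.
move=> GK; rewrite /exclusion_path; case: xgetP => [w _ [_]|nw]; first exact.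
by have [w wE] := exclusion_cadlag sigma GK; case: (nw w).
Qed.

Lemma exclusion_path_out sigma K : ~ Gamma_star K ->
  exclusion_path sigma K = point :> cadlag R (config S).
Proof. by move=> nG; rewrite /exclusion_path; case: xgetP => // w _ []. Qed.

Lemma entourage_config (E : set (config S * config S)) : entourage E ->
  exists F : {fset S}, forall sigma tau,
    (forall x, x \in F -> sigma x = tau x) -> E (sigma, tau).
Proof.
move=> [_ [D _ <-] BE].
have [||F PF] := @fset_uniform _ S D
   (fun p (F : {fset S}) => forall sigma tau,
    (forall x, x \in F -> sigma x = tau x) -> (projT1 p).2 (sigma, tau)).
- move=> p A A' /fsubsetP AA' H sigma tau st; apply: H => x xA.
  by apply: st; exact: AA'.
- move=> [[x V] /= /asboolP[W entW WV]] _; exists [fset (x : S)]%fset => sigma tau st.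
  have stx : sigma x = tau x by apply: st; rewrite in_fset1.
  by apply: WV; change (W (sigma x, tau x)); rewrite stx; exact: entourage_refl.
by exists F => sigma tau st; apply: BE => p pD; exact: PF.
Qed.

(** A Skorohod neighbourhood of a path constrains it at finitely many sites and
    up to a finite time, and there the paths of nearby quiet clocks only differ
    by a small time change. *)
Lemma measurable_exclusion_path sigma :
  measurable_fun [set: borel (clocks R S)]
    (exclusion_path sigma : _ -> borel (cadlag R (config S))).
Proof.
apply: (@measurability _ _ (borel (clocks R S)) (borel (cadlag R (config S)))
  setT (exclusion_path sigma) (@open (cadlag R (config S)))) => //.
move=> _ [U oU <-]; rewrite setTI.
have mG := measurable_Gamma_star.
rewrite (_ : _ @^-1` U =
    (@Gamma_star R S `&` (@Gamma R S `&` quietly_near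
       [set K' | Gamma_star K' -> U (exclusion_path sigma K')]))
    `|` (~` @Gamma_star R S `&` [set K | U point])); last first.
  apply/seteqP; split=> K /=; last first.
    case=> [[GK [_ /(quietly_near_sub GK.1)]]|[nG Up]]; first exact.
    by rewrite exclusion_path_out.
  have [GK UK|nG] := pselect (Gamma_star K); last first.
    by rewrite exclusion_path_out// => Up; right.
  left; split=> //; split; first by case: GK.
  have [T [eps [E [e0 entE ball_U]]]] := oU _ UK.
  have [F PF] := entourage_config entE.
  have sK := backward_site_stable F T GK e0.
  apply: quietly_nearS sK => K' [lam tl cl] GK'; apply: ball_U.
  exists lam => // t tT; have [lt sx] := cl t tT; split=> //.
  have /andP[t0 _] := tT.
  rewrite !exclusion_pathE ?(time_change_ge0 tl)//; apply: PF => x /sx[y [e1 e2]].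
  by rewrite /eta e1 e2.
apply: measurableU; apply: measurableI => //.
- exact: measurable_quietly_near.
- exact: measurableC.
- have [Up|nUp] := pselect (U point).
    by rewrite (_ : mkset _ = setT)//; apply/seteqP; split.
  by rewrite (_ : mkset _ = set0)//; apply/seteqP; split.
Qed.

End ExclusionPath.

(** * The semigroup *)

Section Semigroup.
Variables (R : realType) (S : countType).
Variable P : probability (borel (clocks R S)) R.
Implicit Types (t : R) (f : config S -> R) (sigma tau : config S).

Lemma nbhs_config sigma (F : {fset S}) :
  nbhs sigma [set tau | forall x, x \in F -> tau x = sigma x].
Proof.
apply: (@filter_bigI _ _ F (fun x => [set tau | tau x = sigma x])) => x _.
have cx := @proj_continuous S (fun=> bool) x sigma.
by apply: (cx [set b | b = sigma x]).
Qed.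

Lemma bounded_config f : continuous f -> exists M, forall sigma, `|f sigma| <= M.
Proof.
move=> cf.
have cT : compact [set: config S].
  have := @tychonoff S (fun=> bool) (fun=> setT) (fun=> bool_compact).
  by congr compact; apply/seteqP; split.
have /compact_bounded[M [_ fM]] : compact (f @` setT).
  by apply: continuous_compact cT; apply: continuous_subspaceT => sigma; exact: cf.
exists (M + 1) => sigma; apply: (fM (M + 1)); first by rewrite ltrDl.
by exists sigma.
Qed.

Lemma measurable_semigroup_integrand t f sigma : 0 <= t -> continuous f ->
  measurable_fun [set: borel (clocks R S)]
    (fun K : clocks R S => f (exclusion_path sigma K t)).
Proof.
move=> t0 cf.
apply: (@measurableT_comp _ _ _ (borel (clocks R S)) (borel (cadlag R (config S)))
  _ (fun w : cadlag R (config S) => f (w t))).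
  exact: measurable_evaluation.
exact: measurable_exclusion_path.
Qed.

(** As set functions, on all sets: this turns the integral against the law into
    an integral against an actual measure. *)
Lemma SSEP_lawE sigma : SSEP_law P sigma =
  pushforward (mrestr P (@measurable_Gamma_star R S))
    (exclusion_path sigma : _ -> borel (cadlag R (config S))).
Proof.
apply/funext => A; rewrite /SSEP_law /pushforward /mrestr; congr (P _).
apply/seteqP; split=> K /=.
  move=> [GK [w Aw wE]]; split=> //.
  rewrite (_ : exclusion_path sigma K = w)//; apply: cadlag_ext => t t0.
  by rewrite exclusion_pathE// wE.
move=> [Aw GK]; split=> //; exists (exclusion_path sigma K) => // t t0.
exact: exclusion_pathE.
Qed.

Lemma integrable_semigroup_integrand
    (mu : {measure set (borel (clocks R S)) -> \bar R})
    (D : set (borel (clocks R S))) t f sigma :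
  measurable D -> (mu D < +oo)%E -> 0 <= t -> continuous f ->
  mu.-integrable D (fun K : clocks R S => (f (exclusion_path sigma K t))%:E).
Proof.
move=> mD muD t0 cf; apply: measurable_bounded_integrable => //.
  by apply: measurable_funTS; exact: measurable_semigroup_integrand.
have [M fM] := bounded_config cf; exists M; split; first exact: num_real.
by move=> N MN K _ /=; rewrite (le_trans (fM _))// ltW.
Qed.

Lemma law_semigroupE t f sigma : 0 <= t -> continuous f ->
  SSEP_semigroup P t f sigma = law_semigroup (SSEP_law P) t f sigma.
Proof.
move=> t0 cf; rewrite /law_semigroup SSEP_lawE.
have mG := @measurable_Gamma_star R S.
have restr_fin : (mrestr P mG setT < +oo)%E.
  by rewrite /mrestr setTI (le_lt_trans (probability_le1 P mG))// ltry.
have intf := integrable_semigroup_integrand sigma measurableT restr_fin t0 cf.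
rewrite (@integral_pushforward _ _ _ _ _ _ (measurable_exclusion_path sigma)
  (mrestr P mG) setT (fun w : cadlag R (config S) => (f (w t))%:E)) => //.
- rewrite preimage_setT (@negligible_integral _ _ _ (mrestr P mG) setT
    (~` @Gamma_star R S))//.
  + rewrite setTD setCK; congr fine.
    transitivity (\int[P]_(K in @Gamma_star R S) (f (exclusion_path sigma K t))%:E)%E.
      by apply: eq_integral => K; rewrite inE => GK; rewrite exclusion_pathE.
    by apply: eq_measure_integral => A mA AG /=; rewrite /mrestr setIidl.
  + exact: measurableC.
  + by rewrite /= /mrestr setICl measure0.
- by have /measurable_EFinP := measurable_evaluation cf t0.
Qed.

(** By dominated convergence along configurations agreeing with sigma on larger
    and larger finite sets of sites, which generate the neighbourhoods of sigma
    since S is countable. *)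
Lemma continuous_semigroup t f : 0 <= t -> continuous f ->
  continuous (SSEP_semigroup P t f).
Proof.
move=> t0 cf sigma; apply/cvgrPdist_lt => eps e0; apply: contrapT => far.
pose F (n : nat) : {fset S} := [fset x in pmap choice.unpickle (iota 0 n)]%fset.
have FP n x : (choice.pickle x < n)%N -> x \in F n.
  move=> xn; rewrite !inE /= mem_pmap; apply/mapP; exists (choice.pickle x).
    by rewrite mem_iota.
  by rewrite choice.pickleK.
have /choice[tau tauP] : forall n, exists tau : config S,
    (forall x, x \in F n -> tau x = sigma x) /\
    eps <= `|SSEP_semigroup P t f sigma - SSEP_semigroup P t f tau|.
  move=> n; apply: contrapT => nx; apply: far.
  apply: filterS (nbhs_config sigma (F n)) => tau st; rewrite ltNge.
  by apply/negP => le; apply: nx; exists tau.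
have mG := @measurable_Gamma_star R S.
have PG : (P (@Gamma_star R S) < +oo)%E.
  by rewrite (le_lt_trans (probability_le1 P mG))// ltry.
have [M fM] := bounded_config cf.
pose I sigma := (\int[P]_(K in @Gamma_star R S) (f (exclusion_path sigma K t))%:E)%E.
have IE rho : SSEP_semigroup P t f rho = fine (I rho).
  congr fine; apply: eq_integral => K; rewrite inE => GK.
  by rewrite exclusion_pathE.
have int_f rho := integrable_semigroup_integrand rho mG PG t0 cf.
have cvgI : I (tau n) @[n --> \oo] --> I sigma.
  have [] // := @dominated_convergence _ _ _ P (@Gamma_star R S) mG
    (fun n K => (f (exclusion_path (tau n) K t))%:E)
    (fun K => (f (exclusion_path sigma K t))%:E) (fun=> M%:E).
  - by move=> n; exact: measurable_int (int_f (tau n)).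
  - exact: measurable_int (int_f sigma).
  - apply: aeW => K GK; apply: cvg_EFin; first exact: nearW.
    rewrite exclusion_pathE//.
    have : exclusion_path (tau n) K t @[n --> \oo] --> eta K sigma t.
      apply: cvg_config => x; case E : (backward_site K t x) => [y|]; last first.
        by apply: nearW => n; rewrite exclusion_pathE// /eta E.
      exists (choice.pickle y).+1 => // n /= yn.
      by rewrite exclusion_pathE// /eta E (tauP n).1//; exact: FP.
    by move=> /cvg_comp; apply; exact: cf.
  - exact: finite_measure_integrable_cst.
  - by apply: aeW => K n _ /=; rewrite lee_fin.
have fin_I : I sigma \is a fin_num by exact: integrable_fin_num.
have : fine (I (tau n)) @[n --> \oo] --> fine (I sigma) by apply: fine_cvg; rewrite fineK.
move=> /cvgrPdist_lt/(_ _ e0)[n _ /(_ n (leqnn n))/=].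
by rewrite -!IE ltNge (tauP n).2.
Qed.

End Semigroup.

Theorem proposition3p3 (R : realType) (S : countType)
    (S_infinite : infinite_set [set: S])
    (c : S -> S -> R) (hc : conductances c) (hSSEP : assumption_SSEP c)
    (P : probability (borel (clocks R S)) R) (hP : poisson_clocks c P) :
  (forall (f : config S -> R) (t : R), continuous f -> 0 <= t ->
     (forall sigma : config S,
        SSEP_semigroup P t f sigma = law_semigroup (SSEP_law P) t f sigma) /\
     continuous (SSEP_semigroup P t f)) /\
  feller (SSEP_law P).
Proof.
split=> [f t cf t0|t f t0 cf].
  by split=> [sigma|]; [exact: law_semigroupE|exact: continuous_semigroup].
rewrite (_ : law_semigroup _ t f = SSEP_semigroup P t f).
  exact: continuous_semigroup.
by apply/funext => sigma; rewrite law_semigroupE.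
Qed.
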